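(* Consider the unconstrained nonconvex multi-agent problem and the Zeroth-order Feedback Optimization (ZFO) algorithm described in the context. Suppose $\sigma=0$ (noiseless observations), and let $\epsilon>0$ be sufficiently small. If the algorithm's parameters satisfy $$\eta\leq\frac{\epsilon}{48LG^2\bar b\sqrt{n}\,d},\qquad u\leq\frac{\sqrt{\epsilon}}{4L\sqrt{d}},\qquad T-B+1\geq\left\lceil\frac{6}{\eta\epsilon}\max\{f(x(0))-f^\ast,1\}\right\rceil,$$ then $$\frac{1}{T-B+1}\sum_{t=B}^{T}\mathbb{E}\left[\|\nabla f(x(t))\|^2\right]\leq\epsilon .$$ Moreover, if all the conditions on the parameters are satisfied with equality, then $T=\Theta\left(\dfrac{\bar b\sqrt{n}\,d}{\epsilon^2}\right)$.
   Context: Problem (unconstrained nonconvex setting). There are $n$ agents; agent $i$ has an action $x^i\in\mathbb{R}^{d_i}$, $d=\sum_id_i$, $x=(x^1,\ldots,x^n)\in\mathbb{R}^d$. Each local cost $f_i:\mathbb{R}^d\to\mathbb{R}$ is $G$-Lipschitz and $L$-smooth ($|f_i(x)-f_i(y)|\le G\|x-y\|$, $\|\nabla f_i(x)-\nabla f_i(y)\|\le L\|x-y\|$, $\ell_2$ norms). The objective is $f=\frac1n\sum_{i=1}^nf_i$, possibly nonconvex, and $f^\ast=\inf_{x\in\mathbb{R}^d}f(x)>-\infty$. ZFO algorithm (unconstrained). Parameters: step size $\eta>0$, smoothing radius $u>0$, number of iterations $T\ge B$, an initial action profile $x(0)\in\mathbb{R}^d$. The agents are joined by a communication network, a connected undirected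 graph on $\{1,\ldots,n\}$; $b_{ij}$ is the graph distance between $i$ and $j$. At each time $t=0,1,2,\ldots$: (1) each agent $i$ draws $z^i(t)\sim\mathcal{N}(0,I_{d_i})$, afresh at each time and independently across agents; $z(t)=(z^1(t),\ldots,z^n(t))$; (2) agent $i$ observes $\hat f_i^\pm(t)=f_i(x(t)\pm uz(t))+\varepsilon_i^\pm(t)$ and computes $D_i(t)=\frac{\hat f_i^+(t)-\hat f_i^-(t)}{2u}$; the noises $\varepsilon_i^\pm(t)$ have zero mean and variance at most $\sigma^2$, and are independent of each other and of the action profile; (3) agent $i$ keeps for every $j$ a pair $(D^i_j(t),\tau^i_j(t))$, initialised as $(0,-1)$ at time $-1$. It sets $D^i_i(t)=D_i(t)$, $\tau^i_i(t)=t$; for $j\ne i$ it adopts, among the pairs concerning $j$ received at time $t$ from its neighbours (its own previous pair standing in for a neighbour from which nothing arrives), the one with the largest time stamp; it then sends all its pairs to its neighbours. Thus $D^i_j(t)=D_j(\tau^i_j(t))$, with the convention $D_j(s)=0$, $z(s)=0$ for $s<0$. It forms $G^i(t)=\frac1n\sum_{j=1}^nD^i_j(t)\,z^i(\tau^i_j(t))$; $G(t)=(G^1(t),\ldots,G^n(t))$; (4) $x(t+1)=x(t)-\eta G(t)$. Delays. There is $\Delta\ge0$ with $t-\tau^i_j(t)\le b_{ij}+\Delta$ for all $t\ge0$ and all $i,j$. Define $$\bar b=\left(\frac{\sum_{i,j=1}^n(b_{ij}+\Delta)^2}{n^2}\right)^{1/2},\qquad B=\max_{i,j}b_{ij}+\Delta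 .$$ *)

(* Defs.v *)
From HB Require Import structures.
From mathcomp Require Export all_boot all_order all_algebra.
From mathcomp Require Export all_classical all_reals all_analysis.

Set Implicit Arguments.
Unset Strict Implicit.
Unset Printing Implicit Defensive.

Export Order.TTheory GRing.Theory Num.Theory.
Export numFieldNormedType.Exports.

Local Open Scope classical_set_scope.
Local Open Scope ring_scope.

(* The canonical norm of 'rV[R]_d is the sup norm, hence a separate l2 norm.
   Both induce the same topology, so [differentiable] is the usual notion. *)
Definition norm2 (R : realType) (d : nat) (x : 'rV[R]_d) : R :=
  Num.sqrt (\sum_(k < d) x ord0 k ^+ 2).

Definition grad (R : realType) (d : nat) (g : 'rV[R]_d -> R) (x : 'rV[R]_d) :
    'rV[R]_d :=
  \row_(k < d) 'D_(delta_mx ord0 k) g x.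

Definition lipschitz2 (R : realType) (d : nat) (G : R) (g : 'rV[R]_d -> R) :
    Prop :=
  forall x y, `|g x - g y| <= G * norm2 (x - y).

Definition smooth2 (R : realType) (d : nat) (L : R) (g : 'rV[R]_d -> R) :
    Prop :=
  (forall x, differentiable g x) /\
  (forall x y, norm2 (grad g x - grad g y) <= L * norm2 (x - y)).

Definition objective (R : realType) (n d : nat) (f : 'I_n -> 'rV[R]_d -> R)
    (x : 'rV[R]_d) : R :=
  n%:R^-1 * \sum_(i < n) f i x.

Definition connected_graph (n : nat) (e : rel 'I_n) : Prop :=
  [/\ symmetric e, irreflexive e & forall i j, connect e i j].

(* Least k < n such that some walk with k edges joins i to j; in a connected
   graph on n vertices such a k exists. *)
Definition gdist (n : nat) (e : rel 'I_n) (i j : 'I_n) : nat :=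
  find (fun k => [exists p : k.-tuple 'I_n, path e i p && (last i p == j)])
       (iota 0 n).

Definition bbar (R : realType) (n : nat) (e : rel 'I_n) (Delta : nat) : R :=
  Num.sqrt ((\sum_(i < n) \sum_(j < n) (gdist e i j + Delta)%:R ^+ 2)
            / n%:R ^+ 2).

Definition Bmax (n : nat) (e : rel 'I_n) (Delta : nat) : nat :=
  ((\max_(i < n) \max_(j < n) gdist e i j) + Delta)%N.

Definition mutually_independent (dsp : measure_display)
    (Omega : measurableType dsp) (R : realType) (P : probability Omega R)
    (I : eqType) (X : I -> {RV P >-> R}) : Prop :=
  forall (s : seq I) (A : I -> set R), uniq s ->
    (forall a, measurable (A a)) ->
    P (\bigcap_(a in [set` s]) (X a @^-1` A a)) =
    (\prod_(a <- s) P (X a @^-1` A a))%E.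

(* All the randomness of the algorithm as one family of real random variables:
   the coordinates of the perturbations z(t), and the observation noises
   (xi true t i for the + observation, xi false t i for the - observation). *)
Definition randomness (dsp : measure_display) (Omega : measurableType dsp)
    (R : realType) (P : probability Omega R) (n d : nat)
    (Z : nat -> 'I_d -> {RV P >-> R})
    (xi : bool -> nat -> 'I_n -> {RV P >-> R})
    (a : (nat * 'I_d) + (bool * nat * 'I_n)) : {RV P >-> R} :=
  match a with
  | inl (t, k) => Z t k
  | inr (s, t, i) => xi s t i
  end.

(* z(s), with the convention z(s) = 0 for s < 0. *)
Definition zvec (R : realType) (Omega : Type) (d : nat)
    (z : nat -> 'I_d -> Omega -> R) (s : int) (w : Omega) : 'rV[R]_d :=
  match s with
  | Posz t => \row_(k < d) z t k w
  | Negz _ => 0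
  end.

(* D_i(t), computed from the two noisy observations. *)
Definition zfo_diff (R : realType) (Omega : Type) (n d : nat)
    (f : 'I_n -> 'rV[R]_d -> R) (u : R) (z : nat -> 'I_d -> Omega -> R)
    (xi : bool -> nat -> 'I_n -> Omega -> R) (x : nat -> Omega -> 'rV[R]_d)
    (t : nat) (i : 'I_n) (w : Omega) : R :=
  ((f i (x t w + u *: zvec z t%:Z w) + xi true t i w)
   - (f i (x t w - u *: zvec z t%:Z w) + xi false t i w)) / (2 * u).

(* D t i j and tau t i j are the components of the pair (D^i_j(t), tau^i_j(t)).
   recv s k t i says that the message sent by agent k at time s reaches agent i
   at time t. zfo_candidate lists the pairs concerning j among which agent i
   chooses at time t: those in the messages arriving from its neighbours, its
   own previous pair standing in for a neighbour from which nothing arrives. *)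
Definition zfo_prev (R : realType) (Omega : Type) (n : nat)
    (D : nat -> 'I_n -> 'I_n -> Omega -> R) (tau : nat -> 'I_n -> 'I_n -> int)
    (t : nat) (i j : 'I_n) : (Omega -> R) * int :=
  if t is t'.+1 then (D t' i j, tau t' i j) else (fun=> 0, -1).

Definition zfo_candidate (R : realType) (Omega : Type) (n : nat)
    (e : rel 'I_n) (recv : nat -> 'I_n -> nat -> 'I_n -> bool)
    (D : nat -> 'I_n -> 'I_n -> Omega -> R) (tau : nat -> 'I_n -> 'I_n -> int)
    (t : nat) (i j : 'I_n) (p : (Omega -> R) * int) : Prop :=
  exists2 k, e i k &
    (exists s, [/\ (s < t)%N, recv s k t i & p = (D s k j, tau s k j)]) \/
    ((forall s, (s < t)%N -> ~~ recv s k t i) /\ p = zfo_prev D tau t i j).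

(* G(t), whose block of agent i is (1/n) sum_j D^i_j(t) z^i(tau^i_j(t)). *)
Definition zfo_dir (R : realType) (Omega : Type) (n : nat) (dim : 'I_n -> nat)
    (z : nat -> 'I_(\sum_(i < n) dim i) -> Omega -> R)
    (D : nat -> 'I_n -> 'I_n -> Omega -> R) (tau : nat -> 'I_n -> 'I_n -> int)
    (t : nat) (w : Omega) : 'rV[R]_(\sum_(i < n) dim i) :=
  \mxrow_(i < n) (n%:R^-1 *: \sum_(j < n)
    (D t i j w *: submxrow (zvec z (tau t i j) w) i)).

(* z^i(t) ~ N(0, I), afresh at each time and independently across agents, means
   that all the scalar coordinates Z t k are independent standard normals. *)
Record zfo_run (dsp : measure_display) (Omega : measurableType dsp)
    (R : realType) (P : probability Omega R)
    (n : nat) (dim : 'I_n -> nat) (e : rel 'I_n)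
    (f : 'I_n -> 'rV[R]_(\sum_(i < n) dim i) -> R)
    (eta u sigma : R) (x0 : 'rV[R]_(\sum_(i < n) dim i))
    (recv : nat -> 'I_n -> nat -> 'I_n -> bool)
    (Z : nat -> 'I_(\sum_(i < n) dim i) -> {RV P >-> R})
    (xi : bool -> nat -> 'I_n -> {RV P >-> R})
    (D : nat -> 'I_n -> 'I_n -> Omega -> R)
    (tau : nat -> 'I_n -> 'I_n -> int)
    (x : nat -> Omega -> 'rV[R]_(\sum_(i < n) dim i)) : Prop := ZfoRun {
  zfo_normal : forall t k (A : set R), measurable A ->
    distribution P (Z t k) A = normal_prob 0 1 A;
  zfo_noise_mean : forall s t i, 'E_P[xi s t i]%E = 0%E;
  zfo_noise_var : forall s t i, ('V_P[xi s t i] <= (sigma ^+ 2)%:E)%E;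
  zfo_indep : mutually_independent (randomness Z xi);
  zfo_init : forall w, x 0%N w = x0;
  zfo_own : forall t i,
    D t i i = zfo_diff f u Z xi x t i /\ tau t i i = t%:Z;
  zfo_adopt : forall t i j, j != i ->
    zfo_candidate e recv D tau t i j (D t i j, tau t i j) /\
    (forall p, zfo_candidate e recv D tau t i j p -> p.2 <= tau t i j);
  zfo_step : forall t w, x t.+1 w = x t w - eta *: zfo_dir Z D tau t w
}.

(* Main.v *)
From HB Require Import structures.
Require Import Defs.
From mathcomp Require Import ring lra zify measurable_realfun.

Set Implicit Arguments.
Unset Strict Implicit.
Unset Printing Implicit Defensive.

Local Open Scope classical_set_scope.
Local Open Scope ring_scope.

(** The noise vanishes almost surely, so the iterates are a deterministic
    function of the perturbations, which we read on the space of paths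
    w : nat * 'I_d -> R under the law of independent standard normals.  That
    law is invariant under resampling one coordinate, which gives Gaussian
    integration by parts E[X w_a] = E[d_a X], and under exchanging the
    perturbations of two times.

    By L-smoothness it suffices to bound E<grad F(x_t), G(t)> from below.  Write
    D_j for the difference quotient of f_j and s for a delayed time tau.
    Linearising D_j, two integrations by parts give E[(D_j z_k)^2] <= 4 G^2 for
    small u, hence E|x_t - x_s|^2 <= 4 eta^2 (t - s)^2 G^2 d.  Integration by
    parts also turns E[d_k F(x_s) D_j(s) z_k(s)] into E[d_k F(x_s) d_k D_j(s)],
    and exchanging z(s) for the fresh z(t) makes the perturbation independent of
    the delay; only then are x_s and d_k D_j moved to x_t, at a cost of order
    L eta G^2 bbar sqrt(n) d by Young's inequality, so that the smoothing bias
    L^2 u^2 d is paid once and not once per agent.  Summing the descent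
    inequality over t gives the bound. *)

(** * Euclidean norm, gradients and smoothness *)

(** The Lipschitz bound [|D_j| <= G |z|] alone gives [E[(D_j z_k)^2]] of order [G^2 d], hence a
    direction of squared size [G^2 d^2]; a step size proportional to [1 / d] needs a bound free of
    [d] for each coordinate. The linear part of [D_j] has one because its coefficient, the gradient
    at [x_s], depends on earlier perturbations only. The remainder, of size [L u |z|^2 / 2], enters
    squared and multiplied by [z_k^2]: this is the sixth moment that fixes the degree of all
    integrands, and one reason why [eps] must be small.

    Integrating by parts at time [s] against [grad F(x_t)] would differentiate [grad F], which is
    only Lipschitz, through the dependence of [x_t] on [z(s)]; the gradient is therefore taken at
    [x_s] first. As [s] varies with the receiving agent and with [j], the delayed gradients do not
    form one vector, and comparing them block by block produces the factor [sqrt n].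

    During the first [B] steps some pairs may still be the initial ones. No descent is claimed
    there; Lipschitz continuity bounds the increase of [F] by a constant. *)

Section euclidean.
Context {R : realType} {d : nat}.
Implicit Types (x y v : 'rV[R]_d) (g : 'rV[R]_d -> R).

Definition dot x y : R := \sum_(k < d) x ord0 k * y ord0 k.

Lemma norm2_ge0 x : 0 <= norm2 x. Proof. exact: sqrtr_ge0. Qed.

Lemma norm2_sqr x : norm2 x ^+ 2 = \sum_(k < d) x ord0 k ^+ 2.
Proof. by rewrite sqr_sqrtr// sumr_ge0// => k _; rewrite sqr_ge0. Qed.

Lemma norm2_sqrE x : norm2 x ^+ 2 = dot x x.
Proof. by rewrite norm2_sqr; apply: eq_bigr => k _; rewrite expr2. Qed.

Lemma dotC x y : dot x y = dot y x.
Proof. by apply: eq_bigr => k _; rewrite mulrC. Qed.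

Lemma dotDl x y v : dot (x + y) v = dot x v + dot y v.
Proof. by rewrite -big_split; apply: eq_bigr => k _; rewrite mxE mulrDl. Qed.

Lemma dotZl c x v : dot (c *: x) v = c * dot x v.
Proof. by rewrite mulr_sumr; apply: eq_bigr => k _; rewrite mxE mulrA. Qed.

Lemma dotBl x y v : dot (x - y) v = dot x v - dot y v.
Proof. by rewrite dotDl -scaleN1r dotZl mulN1r. Qed.

Lemma norm2Z c x : norm2 (c *: x) = `|c| * norm2 x.
Proof.
rewrite /norm2 -sqrtr_sqr -sqrtrM ?sqr_ge0//; congr Num.sqrt.
by rewrite mulr_sumr; apply: eq_bigr => k _; rewrite mxE exprMn.
Qed.

Lemma norm2N x : norm2 (- x) = norm2 x.
Proof. by rewrite -scaleN1r norm2Z normrN1 mul1r. Qed.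

Lemma norm2_eq0 x : norm2 x = 0 -> x = 0.
Proof.
move=> x0; apply/rowP => k; rewrite mxE; apply/eqP; rewrite -sqrf_eq0.
have : norm2 x ^+ 2 == 0 by rewrite x0 expr0n.
rewrite norm2_sqr psumr_eq0 => [/allP/(_ k)|i _]; last exact: sqr_ge0.
by rewrite mem_index_enum => /(_ isT).
Qed.

Lemma ler_coord_norm2 x k : `|x ord0 k| <= norm2 x.
Proof.
rewrite -(@ler_pXn2r _ 2) ?nnegrE ?norm2_ge0// norm2_sqr real_normK ?num_real//.
by rewrite (bigD1 k)//= lerDl sumr_ge0// => i _; rewrite sqr_ge0.
Qed.

(** Cauchy-Schwarz: [young] expands the square of [a x - b y]; taking [a = norm2 y] and [b] equal to
    plus or minus [norm2 x] leaves a factor [norm2 x * norm2 y] that divides out for nonzero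
    vectors. *)
Lemma normr_dot_le x y : `|dot x y| <= norm2 x * norm2 y.
Proof.
have young a b : 2 * (a * b) * dot x y <= a ^+ 2 * norm2 x ^+ 2 + b ^+ 2 * norm2 y ^+ 2.
  rewrite !norm2_sqr !mulr_sumr -big_split/=; apply: ler_sum => k _.
  by have := sqr_ge0 (a * x ord0 k - b * y ord0 k); nra.
have [x0|x0] := eqVneq (norm2 x) 0.
  by rewrite (norm2_eq0 x0) /dot big1 ?normr0 ?mulr_ge0 ?norm2_ge0// => k _; rewrite mxE mul0r.
have [y0|y0] := eqVneq (norm2 y) 0.
  by rewrite (norm2_eq0 y0) /dot big1 ?normr0 ?mulr_ge0 ?norm2_ge0// => k _; rewrite mxE mulr0.
have x1 : 0 < norm2 x by rewrite lt_neqAle eq_sym x0 norm2_ge0.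
have y1 : 0 < norm2 y by rewrite lt_neqAle eq_sym y0 norm2_ge0.
have xy : 0 < 2 * (norm2 x * norm2 y) by rewrite mulr_gt0// mulr_gt0.
rewrite ler_norml; apply/andP; split.
  by rewrite -(ler_pM2l xy); have := young (norm2 y) (- norm2 x); lra.
by rewrite -(ler_pM2l xy); have := young (norm2 y) (norm2 x); lra.
Qed.

Lemma norm2D x y : norm2 (x + y) <= norm2 x + norm2 y.
Proof.
rewrite -(@ler_pXn2r _ 2) ?nnegrE ?addr_ge0 ?norm2_ge0//.
rewrite sqrrD !norm2_sqrE dotDl ![dot _ (x + y)]dotC !dotDl (dotC y x).
have := normr_dot_le x y; rewrite ler_norml => /andP[_]; nra.
Qed.

Lemma norm2_sum (I : Type) (r : seq I) (P : pred I) (F : I -> 'rV[R]_d) :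
  norm2 (\sum_(i <- r | P i) F i) <= \sum_(i <- r | P i) norm2 (F i).
Proof.
elim/big_rec2: _ => [|i y z _ h]; last exact: le_trans (norm2D _ _) (lerD _ _).
by rewrite /norm2 big1 ?sqrtr0// => k _; rewrite mxE expr0n.
Qed.

Lemma norm2_le_sum x : norm2 x <= \sum_(k < d) `|x ord0 k|.
Proof.
rewrite {1}(matrix_sum_delta x) big_ord1; apply: le_trans (norm2_sum _ _ _) _.
apply: ler_sum => k _; rewrite norm2Z -[leRHS]mulr1 ler_wpM2l//.
rewrite /norm2 (bigD1 k)//= big1 ?addr0 => [|i ik]; rewrite mxE ?eqxx ?expr1n ?sqrtr1//.
by rewrite (negbTE ik) andbF expr0n.
Qed.

Lemma derive_dot_grad g x v : differentiable g x -> 'D_v g x = dot (grad g x) v.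
Proof.
move=> dg; rewrite deriveE// {1}(matrix_sum_delta v) big_ord1 linear_sum/=.
by apply: eq_bigr => k _; rewrite linearZ/= mxE deriveE// mulrC.
Qed.

Lemma is_derive_line g x v (s : R) : (forall y, differentiable g y) ->
  is_derive s 1 (fun r : R => g (x + r *: v)) (dot (grad g (x + s *: v)) v).
Proof.
move=> dg; have dv : derivable g (x + s *: v) v by exact: diff_derivable.
rewrite -(derive_dot_grad v (dg _)).
have E : (fun h : R => h^-1 *: (((fun r : R => g (x + r *: v)) \o shift s) (h *: (1 : R)) - g (x + s *: v)))
    = (fun h : R => h^-1 *: ((g \o shift (x + s *: v)) (h *: v) - g (x + s *: v))).
  apply/funext => h /=; congr (_ *: (g _ - _)).
  by rewrite /GRing.scale/= mulr1 -/(GRing.scale _ _) scalerDl addrCA addrC -addrA; congr (_ + _); rewrite addrC.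
apply: DeriveDef; first by rewrite /derivable E; exact: dv.
by rewrite /derive E.
Qed.

(** The derivative along [v = grad g x] is [|v|^2], while difference quotients in that direction are
    at most [G |v|]. *)
Lemma norm2_grad_le G g x : 0 <= G -> (forall y, differentiable g y) ->
  lipschitz2 G g -> norm2 (grad g x) <= G.
Proof.
move=> G0 dg lg; set v := grad g x.
have [->//|v0] := eqVneq (norm2 v) 0.
have v1 : 0 < norm2 v by rewrite lt_neqAle eq_sym v0 norm2_ge0.
rewrite -(ler_pM2r v1) -expr2 norm2_sqrE -derive_dot_grad//.
have dv : derivable g x v by exact: diff_derivable.
apply: limr_le => //; near=> h.
have h0 : h != 0 by near: h; exact: nbhs_dnbhs_neq.
rewrite /= (le_trans (ler_norm _))// normrZ normfV ler_pdivrMl ?normr_gt0//.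
by rewrite (le_trans (lg _ _))// addrK norm2Z mulrCA.
Unshelve. all: by end_near. Qed.

(* The function s |-> g (x + s v) - s <grad g x, v> - L s^2 |v|^2 / 2 has
   nonpositive derivative on [0, 1]. *)
Lemma smooth2_ub L g x v : smooth2 L g ->
  g (x + v) <= g x + dot (grad g x) v + L / 2 * norm2 v ^+ 2.
Proof.
move=> [dg sg].
pose h (s : R) := g (x + s *: v) - s * dot (grad g x) v - L / 2 * s ^+ 2 * norm2 v ^+ 2.
have dh (s : R) : is_derive s 1 h (dot (grad g (x + s *: v)) v - dot (grad g x) v - L * s * norm2 v ^+ 2).
  have dl := is_derive_line x v s dg.
  apply: is_derive_eq; rewrite /GRing.scale/= !(mulr0, mul0r, mulr1, addr0, add0r); lra.
have h10 : h 1 <= h 0.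
  apply: (@ler0_derive1_nincr _ h 0 1) => //.
  - move=> s /[!in_itv]/= /andP[s0 s1]; rewrite derive1E derive_val.
    rewrite -dotBl subr_le0 (le_trans (ler_norm _))// (le_trans (normr_dot_le _ _))//.
    rewrite expr2 mulrA ler_wpM2r ?norm2_ge0// (le_trans (sg _ _))//.
    by rewrite addrAC subrr add0r norm2Z (ger0_norm (ltW s0)) mulrA.
  - apply: derivable_within_continuous => s _; exact: ex_derive.
move: h10; rewrite /h scale1r scale0r addr0 expr1n expr0n/= !(mul0r, mul1r, mulr0, mulr1, subr0).
lra.
Qed.

Lemma gradN g x : (forall y, differentiable g y) -> grad (\- g) x = - grad g x.
Proof. by move=> dg; apply/rowP => k; rewrite !mxE deriveN//; exact: diff_derivable. Qed.

Lemma smooth2N L g : smooth2 L g -> smooth2 L (\- g).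
Proof.
move=> [dg sg]; split=> [x|x y]; first exact: differentiableN.
by rewrite !gradN// -opprD norm2N.
Qed.

Lemma smooth2_taylor L g x v : smooth2 L g ->
  `|g (x + v) - g x - dot (grad g x) v| <= L / 2 * norm2 v ^+ 2.
Proof.
move=> sg; have ub := smooth2_ub x v sg.
have lb := smooth2_ub x v (smooth2N sg).
rewrite gradN in lb; last exact: sg.1.
rewrite -scaleN1r dotZl /= in lb.
rewrite ler_norml; apply/andP; split; lra.
Qed.

Lemma lipschitz2_continuous G g : lipschitz2 G g -> continuous g.
Proof.
move=> lg x; apply/(@cvgrPdist_le _ _ _ (nbhs x)) => e e0.
(* Neighbourhoods are those of the sup norm, and [norm2] is at most a sum of [d] absolute
   coordinates; hence the factor [d]. The added 1 keeps [C] positive. *)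
pose C := `|G| * d%:R + 1.
have C0 : 0 < C by rewrite ltr_wpDl// mulr_ge0.
have nx : nbhs x [set y | forall k, `|(x - y) ord0 k| <= e / C].
  exists (fun i j => [set r | `|x i j - r| <= e / C]) => /=.
    move=> i j; apply/nbhs_ballP; exists (e / C); first exact: divr_gt0.
    by move=> r /= /ltW.
  by move=> y xy k; rewrite 2!mxE; exact: xy.
near=> y.
have xy : forall k, `|(x - y) ord0 k| <= e / C by near: y; exact: nx.
have nxy : norm2 (x - y) <= d%:R * (e / C).
  rewrite (le_trans (norm2_le_sum _))// mulr_natl.
  by rewrite -[X in _ <= _ *+ X]card_ord -sumr_const; apply: ler_sum => k _; exact: xy.
rewrite (le_trans (lg _ _))// (@le_trans _ _ (`|G| * (d%:R * (e / C))))//.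
  apply: (@le_trans _ _ (`|G| * norm2 (x - y))); last exact: ler_wpM2l.
  by rewrite ler_wpM2r ?norm2_ge0// ler_norm.
by rewrite !mulrA ler_pdivrMr// (mulrC e) ler_wpM2r ?(ltW e0)// lerDl.
Unshelve. all: by end_near. Qed.

Lemma lipschitz2_grad L g k : smooth2 L g ->
  lipschitz2 L (fun x => grad g x ord0 k).
Proof.
move=> [_ sg] x y; have := ler_coord_norm2 (grad g x - grad g y) k.
by rewrite [X in `|X|]mxE [(- grad g y) _ _]mxE => /le_trans; apply.
Qed.

End euclidean.

(** * The averaged objective *)

Section objective.
Context {R : realType} {n d : nat}.
Variables (f : 'I_n -> 'rV[R]_d -> R) (G L : R).
Hypothesis n0 : (0 < n)%N.
Hypothesis lf : forall i, lipschitz2 G (f i).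
Hypothesis sf : forall i, smooth2 L (f i).

Lemma differentiable_objective x : differentiable (objective f) x.
Proof.
have -> : objective f = n%:R^-1 *: \sum_(i < n) f i.
  by apply/funext => y; rewrite /objective/= fct_sumE.
apply: differentiableZ; apply: differentiable_sum => i; exact: (sf i).1.
Qed.

Lemma grad_objective x : grad (objective f) x = n%:R^-1 *: \sum_(i < n) grad (f i) x.
Proof.
apply/rowP => k; rewrite 2!mxE summxE.
have -> : objective f = n%:R^-1 *: \sum_(i < n) f i.
  by apply/funext => y; rewrite /objective/= fct_sumE.
rewrite deriveZ/=; last by apply: derivable_sum => i; apply: diff_derivable; exact: (sf i).1.
rewrite derive_sum; last by move=> i; apply: diff_derivable; exact: (sf i).1.
by congr (_ * _); apply: eq_bigr => i _; rewrite mxE.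
Qed.

Let mean_le (F : 'I_n -> R) c : (forall i, F i <= c) -> n%:R^-1 * \sum_(i < n) F i <= c.
Proof.
move=> Fc; rewrite ler_pdivrMl ?ltr0n// mulr_natl.
by rewrite -[X in _ <= _ *+ X]card_ord -sumr_const; exact: ler_sum.
Qed.

Lemma lipschitz2_objective : lipschitz2 G (objective f).
Proof.
move=> x y; rewrite /objective -mulrBr -sumrB normrM ger0_norm ?invr_ge0//.
apply: le_trans (mean_le (fun i => lf i x y)).
by rewrite ler_wpM2l ?invr_ge0// ler_norm_sum.
Qed.

Lemma smooth2_objective : smooth2 L (objective f).
Proof.
split=> [x|x y]; first exact: differentiable_objective.
rewrite !grad_objective -scalerBr -sumrB norm2Z ger0_norm ?invr_ge0//.
apply: le_trans (mean_le (fun i => (sf i).2 x y)).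
by rewrite ler_wpM2l ?invr_ge0// norm2_sum.
Qed.

End objective.

(** * Stein's lemma on the line *)

Section gaussian.
Context {R : realType}.
Local Notation mu := (@lebesgue_measure R).
Local Notation phi := (@normal_pdf R 0 1).
Local Notation gauss := (@normal_prob R 0 1).

(** Equal integrals over all measurable sets identify the abstract Radon-Nikodym derivative with
    [phi] almost everywhere; this turns integrals under [gauss] into Lebesgue integrals. *)
Let phi_RN : ae_eq mu setT (Radon_Nikodym_SigmaFinite.f gauss mu) (EFin \o phi).
Proof.
have dom := @normal_prob_dominates R 0 1.
apply: integral_ae_eq => //=.
- exact: Radon_Nikodym_SigmaFinite.f_integrable.
- by apply/measurable_EFinP; exact: measurable_normal_pdf.
- by move=> E _ mE; rewrite -Radon_Nikodym_SigmaFinite.f_integral.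
Qed.

Lemma ge0_integral_normal (f : R -> \bar R) : measurable_fun setT f ->
  (forall y, 0 <= f y)%E ->
  (\int[gauss]_y f y = \int[mu]_y (f y * (phi y)%:E))%E.
Proof.
move=> mf f0; have dom := @normal_prob_dominates R 0 1.
rewrite -(Radon_Nikodym_SigmaFinite.change_of_variables dom)//.
apply: ae_eq_integral => //.
- apply: emeasurable_funM => //.
  exact: measurable_int (Radon_Nikodym_SigmaFinite.f_integrable _).
- apply: emeasurable_funM => //; apply/measurableT_comp => //.
  exact: measurable_normal_pdf.
- exact: ae_eqe_mul2l.
Qed.

Lemma integrable_normal (f : R -> R) : measurable_fun setT f ->
  mu.-integrable setT (fun y => (f y * phi y)%:E) ->
  gauss.-integrable setT (EFin \o f).
Proof.
move=> mf /integrableP[_ fi]; apply/integrableP; split; first exact/measurable_EFinP.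
rewrite ge0_integral_normal//=; last by do 2 apply: measurableT_comp => //.
move: fi; congr (_ < _)%E; apply: eq_integral => y _ /=.
by rewrite normrM (ger0_norm (normal_pdf_ge0 _ _ _)).
Qed.

Lemma integral_normal (f : R -> R) : measurable_fun setT f ->
  gauss.-integrable setT (EFin \o f) ->
  (\int[gauss]_y (f y)%:E = \int[mu]_y (f y * phi y)%:E)%E.
Proof.
move=> mf fi; have dom := @normal_prob_dominates R 0 1.
rewrite -(Radon_Nikodym_change_of_variables dom)//.
have mRN := ae_eq_trans (ae_eq_sym (ae_eq_Radon_Nikodym_SigmaFinite dom measurableT)) phi_RN.
under [RHS]eq_integral do rewrite EFinM.
apply: ae_eq_integral => //.
- apply: emeasurable_funM => //; exact/measurable_EFinP.
- apply: emeasurable_funM => //; first exact/measurable_EFinP.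
  by apply/measurableT_comp => //; exact: measurable_normal_pdf.
- exact: ae_eqe_mul2l.
Qed.

Lemma phiE y : phi y = normal_peak 1 * expR (- (y ^+ 2) / 2).
Proof.
by rewrite normal_pdfE ?oner_neq0// /normal_fun subr0 expr1n mulr2n.
Qed.

(** Half of the exponent absorbs the polynomial: the cubic term in the series of [expR (y^2 / 4)] is
    [y^6 / 384], with 384 = 64 times 3!. *)
Lemma poly6_phi_le y :
  (1 + y ^+ 6) * phi y <= 384 * normal_peak 1 * expR (- (y ^+ 2) / 4).
Proof.
have -> : phi y = normal_peak 1 * expR (- (y ^+ 2) / 4) * expR (- (y ^+ 2) / 4).
  by rewrite phiE -mulrA -expRD; congr (_ * expR _); lra.
have y2 : 0 <= y ^+ 2 / 4 by rewrite divr_ge0 ?sqr_ge0.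
have := expR_ge1Dxn 2 y2.
have -> : (y ^+ 2 / 4) ^+ 3 / 3`!%:R = y ^+ 6 / 384 :> R.
  by rewrite (_ : 3`!%:R = 6)//; field.
move=> e; have e1 : 1 + y ^+ 6 <= 384 * expR (y ^+ 2 / 4) by lra.
have e2 : expR (y ^+ 2 / 4) * expR (- (y ^+ 2) / 4) = 1.
  by rewrite -expRD -(expR0 R); congr expR; lra.
have e3 : (1 + y ^+ 6) * expR (- (y ^+ 2) / 4) <= 384.
  have := ler_wpM2r (expR_ge0 (- (y ^+ 2) / 4)) e1.
  by rewrite -(mulrA 384) e2 mulr1.
have c0 : 0 <= normal_peak 1 * expR (- (y ^+ 2) / 4) by rewrite mulr_ge0 ?expR_ge0 ?normal_peak_ge0.
have := ler_wpM2l c0 e3; lra.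
Qed.

(** Up to a constant, [expR (- y^2 / 4)] is the normal density of standard deviation [sqrt 2]. *)
Lemma integrable_poly6_phi : mu.-integrable setT (fun y => ((1 + y ^+ 6) * phi y)%:E).
Proof.
have s20 : Num.sqrt 2 != 0 :> R by rewrite gt_eqF// sqrtr_gt0.
pose c := 384 * normal_peak 1 / normal_peak (Num.sqrt 2) : R.
apply: (@le_integrable _ _ _ mu setT _ _ (fun y => c%:E * (normal_pdf 0 (Num.sqrt 2) y)%:E)%E) => //.
- apply/measurable_EFinP; apply: measurable_funM; last exact: measurable_normal_pdf.
  by apply: measurable_funD => //; exact: measurable_funX.
- move=> y _ /=; rewrite lee_fin.
  have p0 : 0 <= 1 + y ^+ 6 by rewrite addr_ge0// exprn_even_ge0.
  rewrite (ger0_norm (mulr_ge0 p0 (normal_pdf_ge0 _ _ _))) (le_trans (poly6_phi_le y))//.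
  rewrite (le_trans _ (ler_norm _))// normal_pdfE// /normal_fun subr0 sqr_sqrtr// /c.
  rewrite mulrA divfK ?gt_eqF ?normal_peak_gt0//.
  by rewrite (_ : 2 *+ 2 = 4 :> R)//; lra.
- by apply: integrableZl => //; exact: integrable_normal_pdf.
Qed.

Lemma integrable_normal_poly6 (f : R -> R) C : measurable_fun setT f ->
  (forall y, `|f y| <= C * (1 + y ^+ 6)) -> gauss.-integrable setT (EFin \o f).
Proof.
move=> mf fC; apply: integrable_normal => //.
apply: (@le_integrable _ _ _ mu setT _ _ (fun y => C%:E * ((1 + y ^+ 6) * phi y)%:E)%E) => //.
- by apply/measurable_EFinP/measurable_funM => //; exact: measurable_normal_pdf.
- move=> y _ /=; rewrite lee_fin (le_trans _ (ler_norm _))//.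
  by rewrite normrM (ger0_norm (normal_pdf_ge0 _ _ _)) mulrA ler_wpM2r ?normal_pdf_ge0.
- by apply: integrableZl => //; exact: integrable_poly6_phi.
Qed.

Lemma is_derive_phi (y : R) : is_derive y 1 phi (- y * phi y).
Proof.
have -> : phi = fun y => normal_peak 1 * expR (- (y ^+ 2) / 2).
  by apply/funext => z; rewrite phiE.
apply: is_derive_eq; rewrite /GRing.scale/= !(mulr0, mul0r, mulr1, addr0, add0r); lra.
Qed.

(** The factor in front of [1 + y^4] leaves boundary terms of order [1 / m.+1] in the integration by
    parts. *)
Let phi_decay m : (m.+1%:R ^+ 2 * (1 + m.+1%:R ^+ 4) * phi m.+1%:R : R) <= 768 * normal_peak 1.
Proof.
set y : R := m.+1%:R.
have y1 : 1 <= y ^+ 2 by rewrite expr_ge1// ler1n.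
have := poly6_phi_le y.
have : expR (- (y ^+ 2) / 4) <= 1.
  by rewrite -[leRHS]expR0 ler_expR; have := sqr_ge0 y; lra.
have := normal_peak_ge0 (1 : R).
have := normal_pdf_ge0 0 1 y.
set a := phi y; set p := normal_peak 1; set q := expR _ => a0 p0 q1 h.
have E6 : y ^+ 6 = (y ^+ 2) ^+ 3 by rewrite -exprM.
have E4 : y ^+ 4 = (y ^+ 2) ^+ 2 by rewrite -exprM.
rewrite E6 in h; rewrite E4; move: (y ^+ 2) y1 h => t t1 h1.
have t3 : (t + t ^+ 3) * a <= 2 * (1 + t ^+ 3) * a by rewrite ler_wpM2r//; nra.
have : p * q <= p by rewrite ler_piMr.
by move: h1; rewrite -(mulrA 384) => h1 h2; rewrite mulrDr mulr1 -exprS; lra.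
Qed.

Section stein.
Variables (psi psi' : R -> R) (C : R).
Hypothesis dpsi : forall y : R, is_derive y 1 psi (psi' y).
Hypothesis cpsi' : continuous psi'.
Hypothesis bpsi : forall y, `|psi y| <= C * (1 + y ^+ 4).
Hypothesis bpsi' : forall y, `|psi' y| <= C * (1 + y ^+ 4).

Let C0 : 0 <= C.
Proof. by have := le_trans (normr_ge0 _) (bpsi 0); rewrite expr0n addr0 mulr1. Qed.

Let cpsi : continuous psi.
Proof.
by move=> y; apply/differentiable_continuous/derivable1_diffP; exact: ex_derive.
Qed.

(** The derivative of [psi y * phi y], as [phi' = - y phi]. *)
Let h y := psi' y * phi y - psi y * y * phi y.

Let mpsiM : measurable_fun setT (fun y => psi y * y).
Proof. by apply: measurable_funM => //; exact: continuous_measurable_fun. Qed.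

Let mpsi' : measurable_fun setT psi'.
Proof. exact: continuous_measurable_fun. Qed.

(** Degree 4 for [psi] leaves degree 5 here, within reach of [integrable_poly6_phi]. *)
Let bpsiM y : `|psi y * y| <= 2 * C * (1 + y ^+ 6).
Proof.
rewrite normrM (le_trans (ler_wpM2r (normr_ge0 _) (bpsi y)))//.
rewrite (mulrC 2) -!mulrA ler_wpM2l//.
have E6 : y ^+ 6 = `|y| ^+ 6 by rewrite -normrX ger0_norm// exprn_even_ge0.
have E4 : y ^+ 4 = `|y| ^+ 4 by rewrite -normrX ger0_norm// exprn_even_ge0.
rewrite E6 E4; move: `|y| (normr_ge0 y) => t t0.
have [t1|/ltW t1] := lerP t 1.
  have : t ^+ 4 <= 1 by rewrite exprn_ile1.
  by have := exprn_ge0 6 t0; nra.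
have : t ^+ 5 <= t ^+ 6 by rewrite ler_weXn2l.
have : t <= t ^+ 6 by rewrite -{1}(expr1 t) ler_weXn2l.
by rewrite mulrDl mul1r -exprSr; lra.
Qed.

Let bpsi'6 y : `|psi' y| <= 2 * C * (1 + y ^+ 6).
Proof.
rewrite (le_trans (bpsi' y))// (mulrC 2) -mulrA ler_wpM2l//.
have E6 : y ^+ 6 = (y ^+ 2) ^+ 3 by rewrite -exprM.
have E4 : y ^+ 4 = (y ^+ 2) ^+ 2 by rewrite -exprM.
rewrite E6 E4; move: (y ^+ 2) (sqr_ge0 y) => t t0.
have [t1|/ltW t1] := lerP t 1.
  have : t ^+ 2 <= 1 by rewrite exprn_ile1.
  by have := exprn_ge0 3 t0; nra.
have : t ^+ 2 <= t ^+ 3 by rewrite ler_weXn2l.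
by have := exprn_ge0 3 t0; lra.
Qed.

Lemma stein_integrableM : gauss.-integrable setT (fun y => (psi y * y)%:E).
Proof. exact: integrable_normal_poly6 mpsiM bpsiM. Qed.

Lemma stein_integrable' : gauss.-integrable setT (EFin \o psi').
Proof. exact: integrable_normal_poly6 mpsi' bpsi'6. Qed.

Let mphi : measurable_fun setT phi. Proof. exact: measurable_normal_pdf. Qed.

Let mh : measurable_fun setT h.
Proof.
by apply: measurable_funB; apply: measurable_funM.
Qed.

Let bh y : `|h y| <= 4 * C * ((1 + y ^+ 6) * phi y).
Proof.
rewrite (le_trans (ler_normB _ _))// !normrM (ger0_norm (normal_pdf_ge0 _ _ _)).
have := ler_wpM2r (normal_pdf_ge0 0 1 y) (bpsi'6 y).
have := ler_wpM2r (normal_pdf_ge0 0 1 y) (bpsiM y).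
rewrite normrM; lra.
Qed.

Let ih : mu.-integrable setT (fun y => (4 * C)%:E * ((1 + y ^+ 6) * phi y)%:E)%E.
Proof. by apply: integrableZl => //; exact: integrable_poly6_phi. Qed.

Let F y := psi y * phi y.

Let dF (y : R) : is_derive y 1 F (h y).
Proof.
have d1 := dpsi y; have d2 := is_derive_phi y.
by apply: is_derive_eq; rewrite /GRing.scale/= /h; lra.
Qed.

Let cphi : continuous phi.
Proof. by apply: continuous_normal_pdf; exact: oner_neq0. Qed.

Let ch : continuous h.
Proof.
move=> y; apply: cvgB; apply: cvgM; [exact: cpsi'|exact: cphi| |exact: cphi].
by apply: cvgM; [exact: cpsi|exact: cvg_id].
Qed.

Let cF : continuous F.
Proof. by move=> y; apply: cvgM; [exact: cpsi|exact: cphi]. Qed.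

Let ftc (m : nat) : (\int[mu]_(y in `[(- m.+1%:R)%R, m.+1%:R%R]) (h y)%:E =
  (F m.+1%:R - F (- m.+1%:R))%:E)%E.
Proof.
rewrite (@continuous_FTC2 _ h F) ?EFinB//.
- by rewrite (@lt_trans _ _ 0)// oppr_lt0.
- exact: continuous_subspaceT.
- split; [by move=> y _; exact: ex_derive| |].
  + by apply: cvg_at_right_filter; exact: cF.
  + by apply: cvg_at_left_filter; exact: cF.
- by move=> y _; rewrite derive1E; exact: (@derive_val _ _ _ _ _ _ _ (dF y)).
Qed.

Let Fm m : `|F m.+1%:R - F (- m.+1%:R)| <= 1536 * normal_peak 1 * C * m.+1%:R^-1.
Proof.
have phiN : phi (- m.+1%:R) = phi m.+1%:R by rewrite !phiE sqrrN.
have bF (y : R) : `|F y| <= C * (1 + y ^+ 4) * phi y.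
  by rewrite normrM (ger0_norm (normal_pdf_ge0 _ _ _)) ler_wpM2r ?normal_pdf_ge0.
rewrite (le_trans (ler_normB _ _))//.
have b1 := bF m.+1%:R; have b2 := bF (- m.+1%:R).
have y1 : 1 <= m.+1%:R :> R by rewrite ler1n.
rewrite exprNn -signr_odd expr0 mul1r phiN in b2.
have := phi_decay m; rewrite -/(m.+1%:R : R).
move: (phi _) b1 b2 (normal_pdf_ge0 0 1 (m.+1%:R : R)) => a b1 b2 a0.
move: (m.+1%:R : R) y1 b1 b2 => y y1 b1 b2 b3.
have y0 : 0 < y by lra.
rewrite ler_pdivlMr// (@le_trans _ _ ((2 * (C * (1 + y ^+ 4) * a)) * y))//.
  by rewrite ler_wpM2r ?(ltW y0)//; lra.
have b4 : y * (1 + y ^+ 4) * a <= 768 * normal_peak 1.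
  apply: le_trans b3; rewrite ler_wpM2r// ler_wpM2r//.
    by rewrite addr_ge0// exprn_even_ge0.
  by rewrite expr2 ler_peMl// ltW.
have := ler_wpM2l C0 b4; lra.
Qed.

(** The fundamental theorem on [[- m.+1, m.+1]] leaves only boundary terms, which tend to 0;
    domination by [(1 + y^6) phi] extends this to the whole line. *)
Let int_h : (\int[mu]_y (h y)%:E = 0)%E.
Proof.
pose f_ m : R -> \bar R := (EFin \o h) \_ `[- m.+1%:R, m.+1%:R].
have [|||||_ _ cvf] := @dominated_convergence _ _ _ mu setT measurableT f_ (EFin \o h)
  (fun y => (4 * C)%:E * ((1 + y ^+ 6) * phi y)%:E)%E.
- move=> m; apply/measurable_restrict => //; rewrite setTI.
  by apply/measurable_funTS/measurable_EFinP.
- exact/measurable_EFinP.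
- apply: aeW => y _; apply: cvg_near_cst; near=> m.
  rewrite /f_ patchE mem_set//= in_itv/= -ler_norml.
  near: m; exists (Num.bound `|y|) => // k /= yk.
  rewrite (le_trans (ltW (archi_boundP (normr_ge0 y))))// ler_nat.
  exact: leq_trans yk _.
- exact: ih.
- apply: aeW => y m _; rewrite /f_ patchE; case: ifPn => _.
    by rewrite lee_fin; exact: bh.
  rewrite abse0 lee_fin mulr_ge0 ?mulr_ge0 ?normal_pdf_ge0//.
  by rewrite addr_ge0// exprn_even_ge0.
apply: cvg_unique cvf _ => //.
rewrite (_ : (fun n => _) = (fun m => (F m.+1%:R - F (- m.+1%:R))%:E)); last first.
  by apply/funext => m; rewrite -ftc [RHS]integral_mkcond.
apply: cvg_EFin; first by apply: nearW.
apply: norm_cvg0.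
apply: (@squeeze_cvgr _ _ _ _ (fun=> 0) (fun m => 1536 * normal_peak 1 * C * m.+1%:R^-1)).
- by apply: nearW => m; rewrite normr_ge0 Fm.
- exact: cvg_cst.
- rewrite -[X in _ --> X](mulr0 (1536 * normal_peak 1 * C)).
  by apply: cvgMr; exact: cvg_harmonic.
Unshelve. all: by end_near. Qed.

Lemma stein : (\int[gauss]_y (psi y * y)%:E = \int[gauss]_y (psi' y)%:E)%E.
Proof.
have i1 := stein_integrable'; have i2 := stein_integrableM.
have i3 : mu.-integrable setT (fun y => (psi' y * phi y)%:E).
  apply: (le_integrable measurableT _ _ ih) => [|y _].
    by apply/measurable_EFinP/measurable_funM.
  rewrite /= lee_fin (le_trans _ (ler_norm _))// normrM (ger0_norm (normal_pdf_ge0 _ _ _)).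
  rewrite mulrA ler_wpM2r ?normal_pdf_ge0// (le_trans (bpsi'6 y))//.
  by rewrite ler_wpM2r ?addr_ge0 ?exprn_even_ge0// ler_wpM2r//; lra.
have i4 : mu.-integrable setT (fun y => (psi y * y * phi y)%:E).
  apply: (le_integrable measurableT _ _ ih) => [|y _].
    by apply/measurable_EFinP/measurable_funM.
  rewrite /= lee_fin (le_trans _ (ler_norm _))// normrM (ger0_norm (normal_pdf_ge0 _ _ _)).
  rewrite mulrA ler_wpM2r ?normal_pdf_ge0// (le_trans (bpsiM y))//.
  by rewrite ler_wpM2r ?addr_ge0 ?exprn_even_ge0// ler_wpM2r//; lra.
rewrite !integral_normal//.
have := integralB_EFin measurableT i3 i4; rewrite [X in X = _ -> _]int_h.
have /fineK <- : (\int[mu]_y (psi' y * phi y)%:E)%E \is a fin_num by exact: integrable_fin_num.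
have /fineK <- : (\int[mu]_y (psi y * y * phi y)%:E)%E \is a fin_num by exact: integrable_fin_num.
by rewrite -EFinB => -[/esym/subr0_eq ->].
Qed.

End stein.

End gaussian.

(** * Gaussian measure on the space of paths *)

Section image_law.
Context {d1 d2 : measure_display} {T : measurableType d1} {S : measurableType d2}.
Context {R : realType}.
Variables (m : {measure set T -> \bar R}) (nu : {measure set S -> \bar R}).
Variable phi : T -> S.
Hypothesis mphi : measurable_fun setT phi.
Hypothesis nuE : forall A, measurable A -> nu A = pushforward m phi A.

(** Agreement of the laws on measurable sets is what uniqueness on a generating class supplies.
    Packing [phi] with its measurability makes its [pushforward] a measure. *)
Lemma ge0_integral_image_law (f : S -> \bar R) : measurable_fun setT f ->
  (forall y, 0 <= f y)%E -> (\int[nu]_y f y = \int[m]_x f (phi x))%E.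
Proof.
move=> mf f0; pose g : {mfun T >-> S} := HB.pack phi (isMeasurableFun.Build _ _ _ _ _ mphi).
rewrite (eq_measure_integral (pushforward m g)) => [|A mA _]; last exact: nuE.
by rewrite ge0_integral_pushforward.
Qed.

Lemma integrable_image_law (f : S -> R) :
  nu.-integrable setT (EFin \o f) -> m.-integrable setT (EFin \o (f \o phi)).
Proof.
move=> /integrableP[mf fi]; apply/integrableP; split.
  by apply: (measurableT_comp mf); exact: mphi.
by move: fi; rewrite ge0_integral_image_law//; exact: measurableT_comp.
Qed.

Lemma integral_image_law (f : S -> R) : nu.-integrable setT (EFin \o f) ->
  (\int[nu]_y (f y)%:E = \int[m]_x (f (phi x))%:E)%E.
Proof.
move=> fi; pose g : {mfun T >-> S} := HB.pack phi (isMeasurableFun.Build _ _ _ _ _ mphi).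
rewrite (eq_measure_integral (pushforward m g)) => [|A mA _]; last exact: nuE.
rewrite integral_pushforward//; last exact: integrable_image_law.
by case/integrableP: fi.
Qed.

End image_law.

Section path_space.
Context {R : realType} {I : eqType}.
Local Notation gauss := (@normal_prob R 0 1).

(** Sides equal to [setT] off the finite list allow a condition on every coordinate, so that
    cylinders intersect componentwise. *)
Definition cylinder : set (set (I -> R)) :=
  [set C | exists s A, [/\ uniq s, forall a, measurable (A a),
     forall a, a \notin s -> A a = setT & C = [set w | forall a, A a (w a)]]].

Definition path_space := g_sigma_algebraType cylinder.

(** Finite-dimensional marginals determine the law on [path_space]. No product measure is built: the
    perturbations of a run already induce such a law. *)
Definition gaussian_law (mu : set path_space -> \bar R) :=
  forall s A, uniq s -> (forall a, measurable (A a)) ->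
    mu [set w : path_space | forall a, a \in s -> A a (w a)] = (\prod_(a <- s) gauss (A a))%E.

Lemma cylinder_setI : setI_closed cylinder.
Proof.
move=> _ _ [s [A [us mA As ->]]] [t [B [ut mB Bt ->]]].
exists (undup (s ++ t)), (fun a => A a `&` B a); split.
- exact: undup_uniq.
- by move=> a; exact: measurableI.
- by move=> a; rewrite mem_undup mem_cat negb_or => /andP[/As -> /Bt ->]; rewrite setIT.
- by apply/seteqP; split=> [w [Aw Bw] a|w AB]; split => // a; have [] := AB a.
Qed.

Lemma cylinder_setT : cylinder setT.
Proof. by exists [::], (fun=> setT); split => //; apply/seteqP; split. Qed.

Lemma path_measure_unique (m1 m2 : {measure set path_space -> \bar R}) :
  (m1 setT < +oo)%E -> (forall C, cylinder C -> m1 C = m2 C) ->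
  forall A, measurable A -> m1 A = m2 A.
Proof.
move=> m1oo m12 A mA.
apply: (@measure_unique _ R path_space (cylinder : set (set path_space)) (fun=> setT)) => //.
- exact: cylinder_setI.
- by move=> _; exact: cylinder_setT.
- by rewrite bigcup_const//; exists 0%N.
Qed.

Lemma measurable_coord a : measurable_fun setT (fun w : path_space => w a).
Proof.
move=> _ A mA; rewrite setTI; apply: sub_sigma_algebra.
exists [:: a], (fun b => if b == a then A else setT); split => //.
- by move=> b; case: ifP.
- by move=> b; rewrite inE => /negbTE ->.
- apply/seteqP; split=> [w Aw b|w /(_ a)]; last by rewrite eqxx.
  by case: ifP => [/eqP ->|].
Qed.

Lemma measurable_path d (T : measurableType d) (h : T -> path_space) :
  (forall a, measurable_fun setT (fun x => h x a)) -> measurable_fun setT h.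
Proof.
move=> mh; apply: (@measurability _ _ T path_space setT h (cylinder : set (set path_space))) => // _ [_ [s [A [us mA As ->]]] <-].
rewrite setTI (_ : _ @^-1` _ = \bigcap_(a in [set` s]) ((fun x => h x a) @^-1` A a)).
  by apply: fin_bigcap_measurable => [|a _]; [exact: finite_seq|]; rewrite -[X in measurable X]setTI; exact: mh.
apply/seteqP; split=> [x Ax a _|x Ax a]; first exact: Ax.
by have [/Ax//|/As -> //] := boolP (a \in s).
Qed.

Definition upd (w : path_space) (a : I) (y : R) : path_space :=
  fun b => if b == a then y else w b.

Lemma upd_same w a y : upd w a y a = y. Proof. by rewrite /upd eqxx. Qed.

Lemma measurable_upd a :
  measurable_fun setT (fun p : path_space * R => upd p.1 a p.2).
Proof.
apply: measurable_path => b; rewrite /upd; case: (b == a).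
  exact: measurable_snd.
exact: (measurableT_comp (measurable_coord b) measurable_fst).
Qed.

Variable mu : probability path_space R.
Hypothesis lmu : gaussian_law mu.

Let mu_fin : (mu setT < +oo)%E. Proof. by rewrite probability_setT ltry. Qed.

Let mu_cylinder s A : uniq s -> (forall a, measurable (A a)) ->
  (forall a, a \notin s -> A a = setT) ->
  mu [set w : path_space | forall a, A a (w a)] = (\prod_(a <- s) gauss (A a))%E.
Proof.
move=> us mA As; rewrite -lmu//; congr (mu _); apply/seteqP; split=> w Aw a; first by move=> _.
by have [/Aw//|/As -> //] := boolP (a \in s).
Qed.

(** On a cylinder the preimage is the cylinder freed of its condition at [a], times [B a]; the
    Gaussian mass of [B a] is the factor that was removed. *)
Lemma law_upd a A : measurable A ->
  mu A = pushforward (mu \x gauss)%E (fun p : path_space * R => upd p.1 a p.2) A.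
Proof.
move=> mA; apply: (@path_measure_unique mu
  (pushforward (mu \x gauss)%E (fun p : path_space * R => upd p.1 a p.2)) mu_fin) => //.
  exact: measurable_upd.
move=> mphi _ [s [B [us mB Bs ->]]].
pose B' b := if b == a then setT else B b.
have mB' b : measurable (B' b) by rewrite /B'; case: ifP.
have E : (fun p : path_space * R => upd p.1 a p.2) @^-1` [set w : path_space | forall b, B b (w b)] =
    [set w : path_space | forall b, B' b (w b)] `*` B a.
  apply/seteqP; split=> [[w y] /= Bw|[w y] /= [Bw By] b].
    split; last by have := Bw a; rewrite upd_same.
    by move=> b; rewrite /B'; case: ifPn => // ba; have := Bw b; rewrite /upd (negbTE ba).
  by rewrite /upd; case: ifPn => [/eqP ->//|ba]; have := Bw b; rewrite /B' (negbTE ba).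
have mC : measurable ([set w : path_space | forall b, B' b (w b)] : set path_space).
  apply: sub_sigma_algebra; exists s, B'; split => // b /Bs Bb.
  by rewrite /B' Bb; case: ifP.
transitivity ((mu \x gauss)%E ([set w : path_space | forall b, B' b (w b)] `*` B a)); last first.
  by rewrite -E.
rewrite product_measure1E; [|exact: mC|exact: mB].
rewrite [LHS](mu_cylinder us mB Bs).
rewrite [X in _ = (X * _)%E](@mu_cylinder s B')//; last first.
  by move=> b /Bs Bb; rewrite /B' Bb; case: ifP.
have [as_|as_] := boolP (a \in s).
  rewrite !(big_rem a as_)/= {1}/B' eqxx probability_setT mul1e muleC; congr (_ * _)%E.
  apply: eq_big_seq => b bs; rewrite /B'; case: eqP => // ba.
  by move: bs; rewrite ba (rem_filter _ us) mem_filter/= eqxx.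
rewrite (Bs _ as_) [X in (_ * X)%E](probability_setT gauss) mule1; apply: eq_big_seq => b bs.
by rewrite /B'; case: eqP => // ba; rewrite -ba bs in as_.
Qed.

Lemma measurable_perm (p : I -> I) :
  measurable_fun setT (fun w : path_space => (w \o p : path_space)).
Proof. by apply: measurable_path => a; exact: measurable_coord. Qed.

Lemma law_perm (p : I -> I) A : involutive p -> measurable A ->
  mu A = pushforward mu (fun w : path_space => (w \o p : path_space)) A.
Proof.
move=> pK mA; have mp := measurable_perm p; apply: (@path_measure_unique mu
  (pushforward mu (fun w : path_space => (w \o p : path_space))) mu_fin) => // _ [s [B [us mB Bs ->]]].
have E : (fun w : path_space => (w \o p : path_space)) @^-1` [set w : path_space | forall b, B b (w b)] =
    [set w : path_space | forall b, B (p b) (w b)].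
  by apply/seteqP; split=> w Bw b; have := Bw (p b); rewrite /= pK.
transitivity (mu [set w : path_space | forall b, B (p b) (w b)]); last by rewrite -E.
rewrite [LHS](mu_cylinder us mB Bs) [RHS](@mu_cylinder (map p s) (B \o p))//.
- by rewrite big_map; apply: eq_bigr => b _ /=; rewrite pK.
- by rewrite map_inj_uniq//; exact: inv_inj.
- by move=> b /=; exact: mB.
- by move=> b bs /=; apply: Bs; apply: contra bs => bs; rewrite -(pK b) map_f.
Qed.

Lemma integral_perm (p : I -> I) (X : path_space -> R) : involutive p ->
  mu.-integrable setT (EFin \o X) ->
  (\int[mu]_w (X w)%:E = \int[mu]_w (X (w \o p : path_space))%:E)%E.
Proof.
move=> pK iX; apply: (integral_image_law (measurable_perm p)) => // A mA.
exact: law_perm.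
Qed.

Lemma integral_upd a (X : path_space -> R) :
  mu.-integrable setT (EFin \o X) ->
  (\int[mu]_w (X w)%:E = \int[mu]_w \int[gauss]_y (X (upd w a y))%:E)%E.
Proof.
move=> iX; have mphi := measurable_upd a.
rewrite (@integral_image_law _ _ _ _ _ (mu \x gauss)%E mu _ mphi (@law_upd a) X iX).
rewrite -integral12_prod_meas1//.
exact: (@integrable_image_law _ _ _ _ _ (mu \x gauss)%E mu _ mphi (@law_upd a) X iX).
Qed.

Lemma ge0_integral_coord a (f : R -> \bar R) : measurable_fun setT f ->
  (forall y, 0 <= f y)%E -> (\int[mu]_w f (w a) = \int[gauss]_y f y)%E.
Proof.
move=> mf f0; apply/esym.
apply: (@ge0_integral_image_law _ _ _ _ _ mu gauss (fun w => w a)) => //.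
  exact: measurable_coord.
move=> A mA.
have := lmu (erefl : uniq [:: a]) (fun=> mA); rewrite big_seq1 => /esym E.
rewrite /= [LHS]E /pushforward; congr (mu _); apply/seteqP; split=> [w h|w h]; first by apply: h; rewrite inE.
by move=> b; rewrite inE => /eqP ->.
Qed.

(** Resampling [a] and Fubini reduce to Stein's lemma with the other coordinates frozen, so the
    growth constant may depend on [w]. *)
Lemma gaussian_ibp a (X X' : path_space -> R) :
  mu.-integrable setT (fun w => (X w * w a)%:E) ->
  mu.-integrable setT (EFin \o X') ->
  (forall w (y : R), is_derive y 1 (fun y => X (upd w a y)) (X' (upd w a y))) ->
  (forall w, continuous (fun y => X' (upd w a y))) ->
  (forall w, exists C, forall y, `|X (upd w a y)| <= C * (1 + y ^+ 4) /\
     `|X' (upd w a y)| <= C * (1 + y ^+ 4)) ->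
  (\int[mu]_w (X w * w a)%:E = \int[mu]_w (X' w)%:E)%E.
Proof.
move=> iX iX' dX cX' bX; rewrite (integral_upd a iX) (integral_upd a iX').
apply: eq_integral => w _; have [C bC] := bX w.
under eq_integral do rewrite upd_same.
by apply: (@stein _ _ _ C) => // y; have [] := bC y.
Qed.

End path_space.

(* An open set of R^d is a countable union of cubes with rational data. *)
Lemma measurable_continuous_rV (R : realType) (d : nat) (dT : measure_display)
    (T : measurableType dT) (g : 'rV[R]_d -> R) (X : T -> 'rV[R]_d) :
  continuous g -> (forall k, measurable_fun setT (fun t => X t ord0 k)) ->
  measurable_fun setT (fun t => g (X t)).
Proof.
move=> cg mX; apply: (measurability _ (RGenOpens.measurableE R)).
move=> _ [_ [a [b ->]] <-]; rewrite setTI.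
set V := g @^-1` `]a, b[%classic.
have oV : open V by apply: open_comp => // x _; exact: cg.
pose cube (p : 'rV[rat]_d * nat) : set 'rV[R]_d :=
  [set y | forall k, `|y ord0 k - ratr (p.1 ord0 k)| < p.2.+1%:R^-1].
pose F (N : nat) : set T := if unpickle N is Some p then
  if `[< cube p `<=` V >] then X @^-1` cube p else set0 else set0.
rewrite (_ : _ @^-1` _ = \bigcup_N F N).
  apply: bigcup_measurable => N _; rewrite /F; case: unpickle => // p.
  case: ifP => // _.
  rewrite (_ : _ @^-1` _ = \bigcap_(k in [set: 'I_d])
    ((fun t => X t ord0 k - ratr (p.1 ord0 k)) @^-1` `](- p.2.+1%:R^-1), p.2.+1%:R^-1[%classic)).
    apply: fin_bigcap_measurable => // k _; rewrite -[X in measurable X]setTI.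
    by apply: measurable_funB => //; exact: measurable_itv.
  apply/seteqP; split=> [t h k _|t h k]; first by rewrite /= in_itv/= -ltr_norml; exact: h.
  by have := h k I; rewrite /= in_itv/= -ltr_norml.
apply/seteqP; split=> [t Vt|t [N _]]; last first.
  by rewrite /F; case: unpickle => // p; case: ifPn => // /asboolP pV /pV.
have /nbhs_ballP[e /= e0 eV] : nbhs (X t) V by exact: open_nbhs_nbhs.
(* The cube of half-width [1 / r.+1] around a rational point that close to [X t] contains [X t] and
   has sup-norm diameter below [e]; hence [e / 2]. *)
have [r re] : exists r : nat, r.+1%:R^-1 < e / 2.
  have [r] := ltr_add_invr (divr_gt0 e0 (ltr0n R 2) : 0 < e / 2).
  by rewrite add0r; exists r.
have rr k : exists q : rat, `|X t ord0 k - ratr q| < r.+1%:R^-1.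
  have [|q] := @rat_in_itvoo R (X t ord0 k - r.+1%:R^-1) (X t ord0 k + r.+1%:R^-1).
    by rewrite ltrBlDr -addrA ltrDl addr_gt0.
  by rewrite in_itv/= => /andP[q1 q2]; exists q; rewrite ltr_norml;
    move: (r.+1%:R^-1) q1 q2 => c q1 q2; apply/andP; split; lra.
have [q qX] := choice rr.
exists (pickle (\row_k q k, r)) => //; rewrite /F pickleK.
have tc : cube (\row_k q k, r) (X t) by move=> k /=; rewrite mxE; exact: qX.
case: asboolP => [_//|[]] y yc; apply: eV; split => // i k.
rewrite (ord1 i) /ball/=.
have := yc k; have := tc k => /=; move: (r.+1%:R^-1) re => c ce.
by rewrite !ltr_norml => /andP[? ?] /andP[? ?]; apply/andP; split; lra.
Qed.

(** * Functionals of polynomial growth in finitely many coordinates *)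

Section growth.
Context {R : realType} {I : eqType}.
Local Notation W := (@path_space R I).
Local Notation gauss := (@normal_prob R 0 1).
Variable S : seq I.
Implicit Types (X Y : W -> R) (p q r : nat).

(** Quadratic in the coordinates listed in [S], so exponent [p] in [growth] stands for degree [2 p];
    the added 1 makes the classes increase with [p]. *)
Definition weight (w : W) : R := 1 + \sum_(a <- S) w a ^+ 2.

Lemma weight_ge1 w : 1 <= weight w.
Proof. by rewrite lerDl sumr_ge0// => a _; rewrite sqr_ge0. Qed.

Lemma measurable_weight : measurable_fun setT weight.
Proof.
apply: measurable_funD => //; apply: measurable_sum => a.
by apply: measurable_funX; exact: measurable_coord.
Qed.

(* The path_mean exists for p <= 3, as [weight ^+ 3] is integrable. *)
Definition growth p X := measurable_fun setT X /\
  exists C, forall w, `|X w| <= C * weight w ^+ p.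

Lemma growthP p X : growth p X -> exists2 C, 0 <= C & forall w, `|X w| <= C * weight w ^+ p.
Proof.
move=> [_ [C XC]]; exists C => //.
have := le_trans (normr_ge0 _) (XC (fun=> 0)).
by rewrite pmulr_lge0// exprn_gt0// (lt_le_trans _ (weight_ge1 _)).
Qed.

Lemma growth_dom p X Y : measurable_fun setT X -> growth p Y ->
  (forall w, `|X w| <= Y w) -> growth p X.
Proof.
move=> mX [_ [C YC]] XY; split=> //; exists C => w.
by rewrite (le_trans (XY w))// (le_trans (ler_norm _)).
Qed.

Lemma growthW p q X : (p <= q)%N -> growth p X -> growth q X.
Proof.
move=> pq gX; have [C C0 XC] := growthP gX; split; first exact: gX.1.
by exists C => w; rewrite (le_trans (XC w))// ler_wpM2l// ler_weXn2l// weight_ge1.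
Qed.

Lemma growth_bounded p X C : measurable_fun setT X -> (forall w, `|X w| <= C) -> growth p X.
Proof.
move=> mX XC; apply: (@growthW 0) => //; split => //.
by exists C => w; rewrite expr0 mulr1.
Qed.

Lemma growth_cst p c : growth p (fun=> c).
Proof. by apply: (@growth_bounded _ _ `|c|). Qed.

Lemma growth_coord a : a \in S -> growth 1 (fun w => w a).
Proof.
move=> aS; split; first exact: measurable_coord.
exists 1 => w; rewrite mul1r expr1.
have : w a ^+ 2 <= \sum_(b <- S) w b ^+ 2.
  by rewrite (big_rem a)//= lerDl sumr_ge0// => b _; rewrite sqr_ge0.
have : `|w a| <= 1 + w a ^+ 2.
  rewrite -real_normK ?num_real//; have := sqr_ge0 (`|w a| - 1); have := normr_ge0 (w a); nra.
rewrite /weight; lra.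
Qed.

Lemma growth_coord_sqr a : a \in S -> growth 1 (fun w => w a ^+ 2).
Proof.
move=> aS; split; first by apply: measurable_funX; exact: measurable_coord.
exists 1 => w; rewrite mul1r expr1 ger0_norm ?sqr_ge0// /weight (big_rem a)//=.
have : 0 <= \sum_(b <- rem a S) w b ^+ 2 by rewrite sumr_ge0// => b _; rewrite sqr_ge0.
by move: (w a ^+ 2) (\sum_(_ <- _) _) => p q; lra.
Qed.

Lemma growthD p X Y : growth p X -> growth p Y -> growth p (fun w => X w + Y w).
Proof.
move=> [mX [C XC]] [mY [D YD]]; split; first exact: measurable_funD.
exists (C + D) => w; rewrite mulrDl (le_trans (ler_normD _ _))//.
exact: lerD.
Qed.

Lemma growth_normr p X : growth p X -> growth p (fun w => `|X w|).
Proof.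
move=> [mX [C XC]]; split; first exact: measurableT_comp.
by exists C => w; rewrite normr_id.
Qed.

Lemma growthM p q r X Y : (p + q <= r)%N -> growth p X -> growth q Y ->
  growth r (fun w => X w * Y w).
Proof.
move=> pqr gX gY; have [C C0 XC] := growthP gX; have [D D0 YD] := growthP gY.
apply: growthW pqr _; split; first by apply: measurable_funM; [exact: gX.1|exact: gY.1].
exists (C * D) => w; rewrite normrM exprD mulrACA.
by apply: ler_pM.
Qed.

Lemma growthZ p c X : growth p X -> growth p (fun w => c * X w).
Proof. by move=> gX; apply: (@growthM 0 p) => //; exact: growth_cst. Qed.

Lemma growthN p X : growth p X -> growth p (fun w => - X w).
Proof.
move=> gX; have := growthZ (-1) gX.
by rewrite (_ : (fun w => -1 * X w) = (fun w => - X w))//; apply/funext => w; rewrite mulN1r.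
Qed.

Lemma growthB p X Y : growth p X -> growth p Y -> growth p (fun w => X w - Y w).
Proof. by move=> gX gY; apply: growthD => //; exact: growthN. Qed.

Lemma growth_sum (J : Type) (s : seq J) (P : pred J) p (F : J -> W -> R) :
  (forall j, P j -> growth p (F j)) -> growth p (fun w => \sum_(j <- s | P j) F j w).
Proof.
move=> gF; elim: s => [|j s IH].
  by rewrite (_ : (fun _ => _) = fun=> 0); [exact: growth_cst|apply/funext => w; rewrite big_nil].
rewrite (_ : (fun _ => _) = fun w => (if P j then F j w else 0) + \sum_(i <- s | P i) F i w).
  by apply: growthD => //; case Pj : (P j); [exact: gF|exact: growth_cst].
by apply/funext => w; rewrite big_cons; case: ifP; rewrite ?add0r.
Qed.

Lemma growth_sqr p r X : (p + p <= r)%N -> growth p X -> growth r (fun w => X w ^+ 2).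
Proof. by move=> pr gX; have := growthM pr gX gX; under eq_fun do rewrite -expr2. Qed.

End growth.

(** * Expectation and integration by parts for these functionals *)

Section expectation.
Context {R : realType} {I : eqType}.
Local Notation W := (@path_space R I).
Local Notation gauss := (@normal_prob R 0 1).
Variable mu : probability W R.
Hypothesis lmu : gaussian_law mu.
Variable S : seq I.
Implicit Types (X Y : W -> R).

Definition moment6 : R := \int[gauss]_y (y ^+ 6).

Let integrable_pow6 : gauss.-integrable setT (fun y => (y ^+ 6)%:E).
Proof.
apply: (@integrable_normal_poly6 _ (fun y => y ^+ 6) 1) => [|y]; first exact: measurable_funX.
by rewrite mul1r ger0_norm ?exprn_even_ge0// lerDr.
Qed.

Let integral_coord6 a : (\int[mu]_w (w a ^+ 6)%:E = moment6%:E)%E.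
Proof.
rewrite (@ge0_integral_coord _ _ mu lmu a (fun y => (y ^+ 6)%:E)).
- by rewrite /moment6 /Rintegral fineK//; exact: integrable_fin_num.
- by apply/measurable_EFinP; exact: measurable_funX.
- by move=> y; rewrite lee_fin exprn_even_ge0.
Qed.

Lemma integrable_coord6 a : mu.-integrable setT (fun w => (w a ^+ 6)%:E).
Proof.
apply/integrableP; split.
  by apply/measurable_EFinP/measurable_funX; exact: measurable_coord.
under eq_integral do rewrite gee0_abs ?lee_fin ?exprn_even_ge0//.
by rewrite integral_coord6 ltry.
Qed.

Lemma Rintegral_coord6 a : \int[mu]_w (w a ^+ 6) = moment6.
Proof. by rewrite /Rintegral integral_coord6. Qed.

Lemma integrable_weight3 : mu.-integrable setT (fun w => (weight S w ^+ 3)%:E).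
Proof.
rewrite /weight; elim: S => [|a s IH].
  apply: (eq_integrable measurableT (cst 1%:E)) => [w _|].
    by rewrite big_nil addr0 expr1n.
  exact: finite_measure_integrable_cst.
(* A new coordinate is added through [(q + b)^3 <= 4 (q^3 + b^3)], with [b] its square; this calls
   for the sixth moment. *)
apply: (@le_integrable _ _ _ mu setT _ _ (fun w => 4%:E *
    ((1 + \sum_(b <- s) w b ^+ 2) ^+ 3)%:E + 4%:E * (w a ^+ 6)%:E)%E) => //.
- by apply/measurable_EFinP/measurable_funX; exact: (measurable_weight (a :: s)).
- move=> w _; rewrite big_cons.
  have : 0 <= \sum_(b <- s) w b ^+ 2 by rewrite sumr_ge0// => b _; rewrite sqr_ge0.
  move: (\sum_(_ <- _) _) => q q0; have a0 := sqr_ge0 (w a).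
  rewrite /= lee_fin (_ : w a ^+ 6 = (w a ^+ 2) ^+ 3); last by rewrite -exprM.
  move: (w a ^+ 2) a0 => b b0.
  rewrite [leRHS]ger0_norm ?[leLHS]ger0_norm ?exprn_ge0 ?addr_ge0 ?mulr_ge0 ?exprn_ge0 ?addr_ge0//.
  have := sqr_ge0 (1 + q - b).
  nra.
- apply: integrableD => //; apply: integrableZl => //; exact: integrable_coord6.
Qed.

Lemma growth_integrable X : growth S 3 X -> mu.-integrable setT (EFin \o X).
Proof.
move=> [mX [C XC]].
apply: (@le_integrable _ _ _ mu setT _ _ (fun w => C%:E * (weight S w ^+ 3)%:E)%E) => //.
- exact/measurable_EFinP.
- by move=> w _; rewrite /= lee_fin (le_trans (XC w))// ler_norm.
- by apply: integrableZl => //; exact: integrable_weight3.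
Qed.

Definition path_mean X : R := \int[mu]_w X w.

Lemma meanE X : growth S 3 X -> (\int[mu]_w (X w)%:E = (path_mean X)%:E)%E.
Proof.
by move=> gX; rewrite /path_mean /Rintegral fineK//; apply: integrable_fin_num => //; exact: growth_integrable.
Qed.

Lemma mean_cst c : path_mean (fun=> c) = c.
Proof. by rewrite /path_mean Rintegral_cst// [X in fine X](probability_setT mu) mulr1. Qed.

Lemma meanD X Y : growth S 3 X -> growth S 3 Y ->
  path_mean (fun w => X w + Y w) = path_mean X + path_mean Y.
Proof. by move=> gX gY; apply: RintegralD => //; exact: growth_integrable. Qed.

Lemma meanB X Y : growth S 3 X -> growth S 3 Y ->
  path_mean (fun w => X w - Y w) = path_mean X - path_mean Y.
Proof. by move=> gX gY; apply: RintegralB => //; exact: growth_integrable. Qed.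

Lemma meanZ c X : growth S 3 X -> path_mean (fun w => c * X w) = c * path_mean X.
Proof. by move=> gX; apply: RintegralZl => //; exact: growth_integrable. Qed.

Lemma mean_sum (J : Type) (s : seq J) (P : pred J) (F : J -> W -> R) :
  (forall j, P j -> growth S 3 (F j)) ->
  path_mean (fun w => \sum_(j <- s | P j) F j w) = \sum_(j <- s | P j) path_mean (F j).
Proof.
move=> gF; elim: s => [|j s IH].
  rewrite big_nil -[RHS](mean_cst 0); apply: eq_Rintegral => w _.
  by rewrite big_nil.
rewrite big_cons -IH; case: ifP => Pj.
  rewrite -meanD; [|exact: gF|exact: growth_sum].
  by apply: eq_Rintegral => w _; rewrite big_cons Pj.
by apply: eq_Rintegral => w _; rewrite big_cons Pj.
Qed.

Lemma ler_mean X Y : growth S 3 X -> growth S 3 Y -> (forall w, X w <= Y w) ->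
  path_mean X <= path_mean Y.
Proof. by move=> gX gY XY; apply: le_Rintegral => //; exact: growth_integrable. Qed.

Lemma mean_perm (p : I -> I) X : involutive p -> growth S 3 X ->
  path_mean (fun w => X (w \o p)) = path_mean X.
Proof.
move=> pK gX; rewrite /path_mean /Rintegral; congr fine; apply/esym/integral_perm => //.
exact: growth_integrable.
Qed.

(** The factor [size S] allows [a] to occur several times in [S]. *)
Lemma weight_upd (w : W) a y : weight S (upd w a y) <= weight S w + (size S)%:R * y ^+ 2.
Proof.
rewrite /weight -addrA lerD2l; elim: S => [|b s IH].
  by rewrite !big_nil mul0r addr0.
rewrite !big_cons /= -natr1 mulrDl mul1r addrACA [leRHS]addrC -addrA.
rewrite (@le_trans _ _ (w b ^+ 2 + y ^+ 2 + \sum_(j <- s) upd w a y j ^+ 2))//.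
  rewrite lerD2r /upd; case: eqP => _; first by rewrite lerDr sqr_ge0.
  by rewrite lerDl sqr_ge0.
lra.
Qed.

(** Exponent 2 is what fits: [weight^2] is of degree 4 in the resampled coordinate, as
    [gaussian_ibp] asks, and the product with [w a] has exponent 3, still integrable. *)
Lemma mean_ibp a X X' : a \in S -> growth S 2 X -> growth S 2 X' ->
  (forall w (y : R), is_derive y 1 (fun y => X (upd w a y)) (X' (upd w a y))) ->
  (forall w, continuous (fun y => X' (upd w a y))) ->
  path_mean (fun w => X w * w a) = path_mean X'.
Proof.
move=> aS gX gX' dX cX'; congr fine; apply: (gaussian_ibp lmu) => //.
- apply: growth_integrable; apply: (@growthM _ _ _ 2 1) => //; exact: growth_coord.
- by apply: growth_integrable; exact: growthW gX'.
move=> w; have [C C0 XC] := growthP gX; have [D D0 XD] := growthP gX'.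
pose K := 2 * (weight S w ^+ 2 + (size S)%:R ^+ 2).
have wK y : weight S (upd w a y) ^+ 2 <= K * (1 + y ^+ 4).
  have := weight_upd w a y.
  have := weight_ge1 S (upd w a y); have := weight_ge1 S w.
  rewrite /K (_ : y ^+ 4 = (y ^+ 2) ^+ 2); last by rewrite -exprM.
  move: (weight S w) (weight S (upd w a y)) (sqr_ge0 y) (ler0n R (size S)) => A B.
  move: (y ^+ 2) ((size S)%:R) => t c t0 c0 A1 B1 h.
  have ct : 0 <= c * t by rewrite mulr_ge0.
  have : B ^+ 2 <= (A + c * t) ^+ 2 by rewrite ler_pXn2r ?nnegrE//; lra.
  have := sqr_ge0 (A - c * t); have := sqr_ge0 (A * t); have := sqr_ge0 c.
  nra.
have K0 : 0 <= K by rewrite mulr_ge0// addr_ge0 ?sqr_ge0.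
exists ((C + D) * K) => y; have y0 : 0 <= 1 + y ^+ 4 by rewrite addr_ge0// exprn_even_ge0.
have Ky : 0 <= K * (1 + y ^+ 4) by rewrite mulr_ge0.
rewrite -mulrA; split.
  apply: le_trans (XC _) (le_trans (ler_wpM2l C0 (wK y)) _).
  by apply: ler_wpM2r => //; rewrite lerDl.
apply: le_trans (XD _) (le_trans (ler_wpM2l D0 (wK y)) _).
by apply: ler_wpM2r => //; rewrite lerDr.
Qed.

End expectation.

(** * Difference quotients and the iteration on paths *)

Section difference_quotient.
Context {R : realType} {d : nat}.
Variables (g : 'rV[R]_d -> R) (G L u : R).
Hypotheses (G0 : 0 <= G) (u0 : 0 < u).
Hypotheses (lg : lipschitz2 G g) (sg : smooth2 L g).
Implicit Types x y z : 'rV[R]_d.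

Definition dquot x z : R := (g (x + u *: z) - g (x - u *: z)) / (2 * u).

(* The gradient of [dquot x] with respect to the perturbation. *)
Definition mgrad x z : 'rV[R]_d :=
  2^-1 *: (grad g (x + u *: z) + grad g (x - u *: z)).

Lemma normr_dquot_le x z : `|dquot x z| <= G * norm2 z.
Proof.
rewrite normrM normfV (gtr0_norm (mulr_gt0 (ltr0n _ 2) u0)) ler_pdivrMr ?mulr_gt0//.
rewrite (le_trans (lg _ _))// opprB addrC addrA subrK -scalerDl norm2Z gtr0_norm ?addr_gt0//.
by rewrite -mulrA ler_wpM2l// mulrC mulrDr mulr_natl mulr2n mulrDr.
Qed.

(** Each of the two Taylor remainders is at most [L / 2 * u^2 |z|^2], and their sum is divided by
    [2 u]. *)
Lemma dquot_linear x z :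
  `|dquot x z - dot (grad g x) z| <= L * u / 2 * norm2 z ^+ 2.
Proof.
have h1 := smooth2_taylor x (u *: z) sg.
have h2 := smooth2_taylor x (- u *: z) sg.
rewrite !norm2Z normrN (gtr0_norm u0) !(dotC (grad g x)) !dotZl scaleNr dotC in h1 h2.
have E : dquot x z - dot (grad g x) z = (2 * u)^-1 *
   ((g (x + u *: z) - g x - u * dot (grad g x) z) -
    (g (x - u *: z) - g x - (- u) * dot (grad g x) z)).
  by rewrite /dquot; field; rewrite gt_eqF.
rewrite E normrM normfV (gtr0_norm (mulr_gt0 (ltr0n _ 2) u0)) ler_pdivrMl ?mulr_gt0//.
rewrite (le_trans (ler_normB _ _))// (le_trans (lerD h1 h2))//.
by rewrite exprMn; lra.
Qed.

Lemma normr_mgrad_le x z k : `|mgrad x z ord0 k| <= G.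
Proof.
have dg := sg.1.
have h y : `|grad g y ord0 k| <= G.
  exact: le_trans (ler_coord_norm2 _ _) (norm2_grad_le y G0 dg lg).
rewrite !mxE; have := h (x + u *: z); have := h (x - u *: z); rewrite !mxE.
move: ('D__ _ _) ('D__ _ _) => a b ha hb.
rewrite normrM ger0_norm ?invr_ge0// ler_pdivrMl// (le_trans (ler_normD _ _))//; lra.
Qed.

(** The shifts by [u z] cancel in the differences of arguments, so moving the base point costs the
    same for every perturbation. *)
Lemma mgrad_lipschitz x y z : norm2 (mgrad x z - mgrad y z) <= L * norm2 (x - y).
Proof.
have -> : mgrad x z - mgrad y z = 2^-1 *: ((grad g (x + u *: z) - grad g (y + u *: z)) +
    (grad g (x - u *: z) - grad g (y - u *: z))).
  by rewrite /mgrad -scalerBr opprD addrACA.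
rewrite norm2Z ger0_norm ?invr_ge0// ler_pdivrMl// (le_trans (norm2D _ _))//.
have e1 : x + u *: z - (y + u *: z) = x - y by rewrite opprD addrACA subrr addr0.
have e2 : x - u *: z - (y - u *: z) = x - y by rewrite opprD addrACA subrr addr0.
have h1 := sg.2 (x + u *: z) (y + u *: z); have h2 := sg.2 (x - u *: z) (y - u *: z).
rewrite {}e1 in h1; rewrite {}e2 in h2.
by rewrite (le_trans (lerD h1 h2))// mulr_natl.
Qed.

Lemma mgrad_grad x z : norm2 (mgrad x z - grad g x) <= L * u * norm2 z.
Proof.
have -> : mgrad x z - grad g x = 2^-1 *: ((grad g (x + u *: z) - grad g x) +
    (grad g (x - u *: z) - grad g x)).
  rewrite addrACA -opprD scalerBr /mgrad; congr (_ - _).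
  by rewrite -[X in _ = _ *: (X + X)]scale1r -scalerDl scalerA mulVf ?scale1r// pnatr_eq0.
rewrite norm2Z ger0_norm ?invr_ge0// ler_pdivrMl// (le_trans (norm2D _ _))//.
have e1 : x + u *: z - x = u *: z by rewrite addrAC subrr add0r.
have e2 : x - u *: z - x = - (u *: z) by rewrite addrAC subrr add0r.
have h1 := sg.2 (x + u *: z) x; have h2 := sg.2 (x - u *: z) x.
rewrite {}e1 norm2Z gtr0_norm// mulrA in h1.
rewrite {}e2 norm2N norm2Z gtr0_norm// mulrA in h2.
by rewrite (le_trans (lerD h1 h2))// mulr_natl.
Qed.

Lemma is_derive_dquot x z k (s : R) :
  is_derive s 1 (fun r : R => dquot x (z + r *: delta_mx ord0 k))
    (mgrad x (z + s *: delta_mx ord0 k) ord0 k).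
Proof.
have dg := sg.1; set v := delta_mx ord0 k.
have d1 := is_derive_line (x + u *: z) (u *: v) s dg.
have d2 := is_derive_line (x - u *: z) (- (u *: v)) s dg.
have E : (fun r : R => dquot x (z + r *: v)) = (fun r : R => (2 * u)^-1 *
    (g (x + u *: z + r *: (u *: v)) - g (x - u *: z + r *: - (u *: v)))).
  apply/funext => r; rewrite /dquot mulrC; congr (_ * (g _ - g _)).
    by rewrite scalerDr addrA !scalerA mulrC.
  by rewrite scalerDr opprD addrA scalerN !scalerA mulrC.
have dotv a : dot a (u *: v) = u * a ord0 k.
  rewrite dotC dotZl dotC /dot (bigD1 k)//= big1 ?addr0 => [|i ik].
    by rewrite mxE !eqxx mulr1.
  by rewrite mxE (negbTE ik) andbF mulr0.
have dotNv a : dot a (- (u *: v)) = - (u * a ord0 k).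
  by rewrite dotC -scaleN1r dotZl dotC dotv mulN1r.
have ep (r : R) : x + u *: z + r *: (u *: v) = x + u *: (z + r *: v).
  by rewrite scalerDr addrA !scalerA mulrC.
have em (r : R) : x - u *: z + r *: (- (u *: v)) = x - u *: (z + r *: v).
  by rewrite scalerDr opprD addrA scalerN !scalerA mulrC.
rewrite dotv ep in d1; rewrite dotNv em in d2.
rewrite E; apply: is_derive_eq; rewrite /GRing.scale/=.
rewrite [mgrad _ _ _ _]mxE [X in _ = _ * X]mxE.
by field; rewrite gt_eqF.
Qed.

Lemma continuous_mgrad_line x z v k :
  continuous (fun r : R => mgrad x (z + r *: v) ord0 k).
Proof.
have cl c : continuous (fun r : R => x + c *: (z + r *: v)).
  move=> r; apply: cvgD; first exact: cvg_cst.
  apply: cvgZ; first exact: cvg_cst.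
  apply: cvgD; first exact: cvg_cst.
  by apply: cvgZ; [exact: cvg_id|exact: cvg_cst].
have cg := lipschitz2_continuous (lipschitz2_grad k sg).
have cc c : continuous (fun r : R => grad g (x + c *: (z + r *: v)) ord0 k).
  move=> r; exact: (@continuous_comp _ _ _ (fun r : R => x + c *: (z + r *: v))
    (fun y => grad g y ord0 k) r (cl c r) (cg _)).
rewrite (_ : (fun r => _) = fun r => 2^-1 * (grad g (x + u *: (z + r *: v)) ord0 k +
    grad g (x + (- u) *: (z + r *: v)) ord0 k)).
  move=> r; apply: cvgM; first exact: cvg_cst.
  by apply: cvgD; exact: cc.
by apply/funext => r; rewrite [LHS]mxE [X in _ * X]mxE scaleNr.
Qed.

End difference_quotient.

(** The delay depends on the agent owning the coordinate, so the coordinates of a delayed gradient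
    come from [n] vectors. Charging each block with its whole vector is what turns [bbar] into
    [bbar * sqrt n]. *)
Lemma sum_block_sqr_le (R : realType) (n d : nat) (blk : 'I_d -> 'I_n)
    (V : 'I_n -> 'rV[R]_d) :
  \sum_(k < d) V (blk k) ord0 k ^+ 2 <= \sum_(i < n) norm2 (V i) ^+ 2.
Proof.
rewrite (partition_big blk xpredT)//=; apply: ler_sum => i _.
rewrite norm2_sqr [leRHS](bigID (fun k => blk k == i))/=.
rewrite (eq_bigr (fun k => V i ord0 k ^+ 2)) => [|k /eqP ->//].
by rewrite lerDl sumr_ge0// => k _; rewrite sqr_ge0.
Qed.

(** The sum is at most [d] times its largest term, whose cube is one of the summands on the
    right. *)
Lemma sum_cube_le (R : realType) (d : nat) (t : 'I_d -> R) :
  (forall l, 0 <= t l) ->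
  (\sum_(l < d) t l) ^+ 3 <= d%:R ^+ 3 * \sum_(l < d) t l ^+ 3.
Proof.
move=> t0; case: d t t0 => [|d] t t0; first by rewrite !big_ord0 expr0n/= mulr0.
have [l _ lmax] := @arg_maxP _ _ _ ord0 xpredT t isT.
apply: (@le_trans _ _ ((d.+1%:R * t l) ^+ 3)).
  rewrite ler_pXn2r ?nnegrE ?sumr_ge0 ?mulr_ge0// mulr_natl.
  by rewrite -[X in _ <= _ *+ X]card_ord -sumr_const; apply: ler_sum => i _; exact: lmax.
rewrite exprMn ler_wpM2l ?exprn_ge0// (bigD1 l)//= lerDl sumr_ge0// => i _.
exact: exprn_ge0.
Qed.

Lemma sqr_sum_le (R : realType) (n : nat) (a : 'I_n -> R) :
  (\sum_(i < n) a i) ^+ 2 <= n%:R * \sum_(i < n) a i ^+ 2.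
Proof.
pose one : 'rV[R]_n := const_mx 1; pose v : 'rV[R]_n := \row_i a i.
have -> : \sum_(i < n) a i = dot one v by apply: eq_bigr => i _; rewrite !mxE mul1r.
have -> : \sum_(i < n) a i ^+ 2 = norm2 v ^+ 2.
  by rewrite norm2_sqr; apply: eq_bigr => i _; rewrite mxE.
have -> : n%:R = norm2 one ^+ 2.
  rewrite norm2_sqr; under eq_bigr do rewrite mxE expr1n.
  by rewrite sumr_const card_ord.
rewrite -exprMn -[leLHS]real_normK ?num_real//.
by rewrite ler_pXn2r ?nnegrE ?mulr_ge0 ?norm2_ge0// normr_dot_le.
Qed.

(** * The noiseless iteration driven by a path *)

Section zfo_path.
Context {R : realType} {n d : nat}.
Variables (f : 'I_n -> 'rV[R]_d -> R) (eta u : R) (x0 : 'rV[R]_d).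
Variables (blk : 'I_d -> 'I_n) (tau : nat -> 'I_n -> 'I_n -> int).
Hypothesis tau_le : forall t i j, tau t i j <= t%:Z.
Local Notation W := (@path_space R (nat * 'I_d)%type).
Implicit Types (w : W) (x : nat -> 'rV[R]_d).

Definition pert w (t : nat) : 'rV[R]_d := \row_k w (t, k).

(** The exchanged pairs are eliminated: a value concerning [j] with a nonnegative stamp is the
    difference quotient of [f j] at that stamp. The case [Negz] is the convention [z(s) = 0] for
    [s < 0]. *)
Definition dterm x w t j k : R :=
  match tau t (blk k) j with
  | Posz s => dquot (f j) u (x s) (pert w s) * w (s, k)
  | Negz _ => 0
  end.

Definition dir x w t : 'rV[R]_d := \row_k (n%:R^-1 * \sum_(j < n) dterm x w t j k).

(* [hist w t s] is the iterate x(s) for s <= t; a step may read all earlier ones. *)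
Fixpoint hist w t : nat -> 'rV[R]_d :=
  if t is t'.+1 then fun s => if (s <= t')%N then hist w t' s
    else hist w t' t' - eta *: dir (hist w t') w t'
  else fun=> x0.

Definition pos w t := hist w t t.

Lemma histE w t s : (s <= t)%N -> hist w t s = pos w s.
Proof.
elim: t => [|t IH]; first by rewrite leqn0 => /eqP ->.
rewrite leq_eqVlt => /predU1P[->//|]; rewrite ltnS => st /=.
by rewrite st IH.
Qed.

Lemma eq_dterm x x' w w' t j k : (forall s, (s <= t)%N -> x s = x' s) ->
  (forall s l, (s <= t)%N -> w (s, l) = w' (s, l)) ->
  dterm x w t j k = dterm x' w' t j k.
Proof.
move=> xx ww; rewrite /dterm; case E : (tau t (blk k) j) => [s|//].
have st : (s <= t)%N by have := tau_le t (blk k) j; rewrite E lez_nat.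
by rewrite xx// ww//; congr (dquot _ _ _ _ * _); apply/rowP => l; rewrite !mxE ww.
Qed.

Lemma eq_dir x x' w w' t : (forall s, (s <= t)%N -> x s = x' s) ->
  (forall s l, (s <= t)%N -> w (s, l) = w' (s, l)) -> dir x w t = dir x' w' t.
Proof.
move=> xx ww; apply/rowP => k; rewrite !mxE; congr (_ * _).
by apply: eq_bigr => j _; exact: eq_dterm.
Qed.

Lemma pos0 w : pos w 0 = x0. Proof. by []. Qed.

Lemma posS w t : pos w t.+1 = pos w t - eta *: dir (pos w) w t.
Proof.
rewrite {1}/pos /= ltnn; congr (_ - _ *: _); apply: eq_dir => // s st.
exact: histE.
Qed.

Lemma posS_coord w t k :
  pos w t.+1 ord0 k = pos w t ord0 k - eta * dir (pos w) w t ord0 k.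
Proof. by rewrite posS [LHS]mxE [X in _ + X]mxE [X in - X]mxE. Qed.

Lemma eq_pos w w' t : (forall s l, (s < t)%N -> w (s, l) = w' (s, l)) -> pos w t = pos w' t.
Proof.
elim/ltn_ind: t => -[//|t] IH ww; rewrite !posS.
have ps s : (s <= t)%N -> pos w s = pos w' s.
  by move=> st; apply: IH => // r l rs; apply: ww; rewrite (leq_trans rs)// ltnW.
by rewrite ps//; congr (_ - _ *: _); apply: eq_dir => // s l st; exact: ww.
Qed.

Lemma pos_upd w s k y t : (t <= s)%N -> pos (upd w (s, k) y) t = pos w t.
Proof.
move=> ts; apply: eq_pos => r l rt; rewrite /upd; case: eqP => // -[rs _].
by move: (leq_trans rt ts); rewrite rs ltnn.
Qed.

Lemma pert_upd w s k y : pert (upd w (s, k) y) s =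
  (pert w s - w (s, k) *: delta_mx ord0 k) + y *: delta_mx ord0 k.
Proof.
apply/rowP => l; rewrite !mxE /upd xpair_eqE eqxx/=.
by case: eqP => [->|_]; rewrite ?mulr1 ?mulr0 ?subrr ?subr0 ?addr0 ?add0r.
Qed.

(** A relabelling of coordinates, hence law preserving. For [s <= t] it turns the perturbation at
    time [s] into the one at time [t] and fixes [pos w s], which reads only times before [s]. *)
Definition swap_time (s t : nat) (a : nat * 'I_d) : nat * 'I_d :=
  (if a.1 == s then t else if a.1 == t then s else a.1, a.2).

Lemma swap_timeK s t : involutive (swap_time s t).
Proof.
move=> [r k]; rewrite /swap_time/=; congr pair.
case: (eqVneq r s) => [->|rs]; first by case: (eqVneq t s) => [->//|ts]; rewrite eqxx.
by case: (eqVneq r t) => [->|rt]; rewrite ?eqxx// (negbTE rs) (negbTE rt).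
Qed.

Lemma pos_swap w s t : (s <= t)%N -> pos (w \o swap_time s t) s = pos w s.
Proof.
move=> st; apply: eq_pos => r l rs; rewrite /swap_time/=.
by rewrite (ltn_eqF rs) (ltn_eqF (leq_trans rs st)).
Qed.

Lemma pert_swap w s t : pert (w \o swap_time s t) s = pert w t.
Proof. by apply/rowP => l; rewrite !mxE /swap_time/= eqxx. Qed.

Variable m : nat.

Definition horizon : seq (nat * 'I_d) := [seq (s, k) | s <- iota 0 m, k <- enum 'I_d].

Lemma mem_horizon s k : ((s, k) \in horizon) = (s < m)%N.
Proof.
apply/allpairsP/idP => [[[s' k'] /= [+ _ [-> _]]]|sm]; first by rewrite mem_iota add0n.
by exists (s, k); rewrite /= mem_iota mem_enum.
Qed.

Variables (G L : R).
Hypotheses (n0 : (0 < n)%N) (G0 : 0 < G) (L0 : 0 < L) (u0 : 0 < u) (eta0 : 0 < eta).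
Hypothesis lf : forall i, lipschitz2 G (f i).
Hypothesis sf : forall i, smooth2 L (f i).
Local Notation growth := (growth horizon).

Lemma growth_pert_sqr s : (s < m)%N -> growth 1 (fun w => norm2 (pert w s) ^+ 2).
Proof.
move=> sm; rewrite (_ : (fun w => _) = fun w => \sum_(k < d) w (s, k) ^+ 2).
  by apply: growth_sum => k _; apply: growth_coord_sqr; rewrite mem_horizon.
by apply/funext => w; rewrite norm2_sqr; apply: eq_bigr => k _; rewrite mxE.
Qed.

Lemma measurable_pert s k : measurable_fun setT (fun w => pert w s ord0 k).
Proof.
rewrite (_ : (fun w => _) = fun w => w (s, k)); first exact: measurable_coord.
by apply/funext => w; rewrite mxE.
Qed.

Lemma measurable_pos_pert (X : W -> 'rV[R]_d) s c :
  (forall k, measurable_fun setT (fun w => X w ord0 k)) ->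
  forall k, measurable_fun setT (fun w => (X w + c *: pert w s) ord0 k).
Proof.
move=> mX k; rewrite (_ : (fun w => _) = fun w => X w ord0 k + c * pert w s ord0 k).
  apply: measurable_funD => //; apply: measurable_funM => //; exact: measurable_pert.
by apply/funext => w; rewrite [LHS]mxE [X in _ + X]mxE.
Qed.

Lemma measurable_dquot (X : W -> 'rV[R]_d) s j :
  (forall k, measurable_fun setT (fun w => X w ord0 k)) ->
  measurable_fun setT (fun w => dquot (f j) u (X w) (pert w s)).
Proof.
move=> mX; apply: measurable_funM => //; apply: measurable_funB.
  apply: (@measurable_continuous_rV _ _ _ _ (f j) (fun w => X w + u *: pert w s)).
    exact: lipschitz2_continuous (lf j).
  exact: measurable_pos_pert.
have E : (fun w => f j (X w - u *: pert w s)) = (fun w => f j (X w + (- u) *: pert w s)).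
  by apply/funext => w; rewrite scaleNr.
rewrite E; apply: (@measurable_continuous_rV _ _ _ _ (f j) (fun w => X w + (- u) *: pert w s)).
  exact: lipschitz2_continuous (lf j).
exact: measurable_pos_pert.
Qed.

Lemma normr_dquotM_le j (v z : 'rV[R]_d) k : `|dquot (f j) u v z * z ord0 k| <= G * norm2 z ^+ 2.
Proof.
rewrite normrM expr2 mulrA; apply: ler_pM => //.
  exact: (normr_dquot_le (ltW G0) u0 (lf j)).
exact: ler_coord_norm2.
Qed.

Lemma growth_dquotM (X : W -> 'rV[R]_d) s j k : (s < m)%N ->
  (forall k, measurable_fun setT (fun w => X w ord0 k)) ->
  growth 1 (fun w => dquot (f j) u (X w) (pert w s) * w (s, k)).
Proof.
move=> sm mX; apply: (@growth_dom _ _ _ _ _ (fun w => G * norm2 (pert w s) ^+ 2)).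
- by apply: measurable_funM; [exact: measurable_dquot|exact: measurable_coord].
- by apply: growthZ; exact: growth_pert_sqr.
- by move=> w; have := normr_dquotM_le j (X w) (pert w s) k; rewrite [pert w s ord0 k]mxE.
Qed.

(** The bound [G |z|^2] on each term of an increment does not involve the iterate, so the exponent
    does not accumulate along the iteration. *)
Lemma growth_pos t k : (t <= m)%N -> growth 1 (fun w => pos w t ord0 k).
Proof.
elim/ltn_ind: t k => -[|t] IH k tm; first by under eq_fun do rewrite pos0; exact: growth_cst.
rewrite (_ : (fun w => _) = fun w => pos w t ord0 k - eta * (n%:R^-1 * \sum_(j < n) dterm (pos w) w t j k)).
  apply: growthB; first by apply: IH => //; exact: ltnW.
  apply: growthZ; apply: growthZ; apply: growth_sum => j _; rewrite /dterm.
  case E : (tau t (blk k) j) => [s|s]; last exact: growth_cst.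
  have st : (s <= t)%N by have := tau_le t (blk k) j; rewrite E lez_nat.
  have sm := leq_ltn_trans st tm.
  apply: growth_dquotM => // l; by apply: (IH s _ l _).1 => //; exact: ltnW.
by apply/funext => w; rewrite posS_coord [dir _ _ _ _ _]mxE.
Qed.

Lemma measurable_pos t k : (t <= m)%N -> measurable_fun setT (fun w => pos w t ord0 k).
Proof. by move=> tm; exact: (growth_pos k tm).1. Qed.

Lemma growth_grad (g : 'rV[R]_d -> R) (X : W -> 'rV[R]_d) k p :
  lipschitz2 G g -> smooth2 L g ->
  (forall k, measurable_fun setT (fun w => X w ord0 k)) ->
  growth p (fun w => grad g (X w) ord0 k).
Proof.
move=> lg sg mX.
have mg := measurable_continuous_rV (lipschitz2_continuous (lipschitz2_grad k sg)) mX.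
apply: (@growth_bounded _ _ horizon p _ G mg) => w; apply: le_trans (ler_coord_norm2 _ _) _.
by apply: norm2_grad_le => //; [exact: ltW|exact: sg.1].
Qed.

Variable mu : probability W R.
Hypothesis lmu : gaussian_law mu.
Local Notation mean := (path_mean mu).

Lemma mean_coord_sqr s k : (s < m)%N -> mean (fun w => w (s, k) ^+ 2) = 1.
Proof.
move=> sm; rewrite -[RHS](mean_cst mu 1).
apply: (@mean_ibp _ _ mu lmu horizon (s, k) (fun w => w (s, k)) (fun=> 1)).
- by rewrite mem_horizon.
- by apply: growthW (growth_coord _); rewrite ?mem_horizon.
- exact: growth_cst.
- move=> w y; rewrite (_ : (fun y => _) = id); first exact: is_derive_id.
  by apply/funext => z; rewrite upd_same.
- by move=> w y; exact: cvg_cst.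
Qed.

Lemma mean_pert_sqr s : (s < m)%N -> mean (fun w => norm2 (pert w s) ^+ 2) = d%:R.
Proof.
move=> sm; rewrite (_ : (fun w => _) = fun w => \sum_(k < d) w (s, k) ^+ 2).
  rewrite (mean_sum lmu (S := horizon)) => [|k _].
    by under eq_bigr do rewrite mean_coord_sqr//; rewrite sumr_const card_ord.
  by apply: growthW (growth_coord_sqr _); rewrite ?mem_horizon.
by apply/funext => w; rewrite norm2_sqr; apply: eq_bigr => k _; rewrite mxE.
Qed.

(** Controls the linearisation remainder: with [c = L u / 2] and the [d^3] of [sum_cube_le], its
    share of the second moment is a quarter of the left side, at most [G^2 / 4]. *)
Hypothesis small_u : 5 * L ^+ 2 * u ^+ 2 * (d%:R ^+ 4 * moment6) <= G ^+ 2.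

(** * Second moment of one coordinate of the estimator *)

Section second_moment.
Variables (s : nat) (j : 'I_n) (k : 'I_d).
Hypothesis sm : (s < m)%N.

Let g w := grad (f j) (pos w s).
Let lin w := dot (g w) (pert w s).

Let gg l p : growth p (fun w => g w ord0 l).
Proof. by apply: growth_grad => // i; exact: measurable_pos (ltnW sm). Qed.

Let g_le w : norm2 (g w) <= G.
Proof. by apply: norm2_grad_le => //; [exact: ltW|exact: (sf j).1]. Qed.

Let glin : growth 1 lin.
Proof.
apply: growth_sum => l _; apply: (@growthM _ _ _ 0 1) => //.
under eq_fun do rewrite mxE; apply: growth_coord; by rewrite mem_horizon.
Qed.

(** Bounding by [G^2 |z|^2] gives exponent 1 where multiplying two factors of exponent 1 would give
    2; this leaves room for [lin^2 * w (s, k)] in [mean_ibp]. *)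
Let glin2 : growth 1 (fun w => lin w ^+ 2).
Proof.
apply: (@growth_dom _ _ _ _ _ (fun w => G ^+ 2 * norm2 (pert w s) ^+ 2)).
- by apply: measurable_funX; exact: glin.1.
- by apply: growthZ; exact: growth_pert_sqr.
- move=> w; rewrite normrX -exprMn ler_pXn2r ?nnegrE ?mulr_ge0 ?norm2_ge0 ?(ltW G0)//.
  by rewrite (le_trans (normr_dot_le _ _))// ler_wpM2r ?norm2_ge0.
Qed.

Let lin_upd w l y : lin (upd w (s, l) y) =
  dot (g w) (pert w s - w (s, l) *: delta_mx ord0 l) + y * g w ord0 l.
Proof.
rewrite /lin /g pos_upd// pert_upd dotC dotDl dotZl; congr (_ + _ * _); first exact: dotC.
rewrite dotC /dot (bigD1 l)//= big1 ?addr0 => [|i ik].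
  by rewrite [X in _ * X]mxE !eqxx mulr1.
by rewrite [X in _ * X]mxE (negbTE ik) andbF mulr0.
Qed.

(** [g w] depends on perturbations before time [s] only, so [g_l * lin] is affine in the coordinate
    [(s, l)], with slope [g_l^2]. *)
Let mean_lin l : mean (fun w => g w ord0 l * lin w * w (s, l)) = mean (fun w => g w ord0 l ^+ 2).
Proof.
apply: (@mean_ibp _ _ mu lmu horizon).
- by rewrite mem_horizon.
- by apply: (growthM _ (gg l 0) glin).
- by apply: (growth_sqr _ (gg l 0)).
- move=> w y; rewrite (_ : (fun y => _) = fun y => g w ord0 l *
    (dot (g w) (pert w s - w (s, l) *: delta_mx ord0 l) + y * g w ord0 l)).
    by apply: is_derive_eq; rewrite /g pos_upd// /GRing.scale/=; ring.
  by apply/funext => z; rewrite lin_upd /g pos_upd.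
- move=> w; rewrite (_ : (fun y => _) = fun=> g w ord0 l ^+ 2); first by move=> y; exact: cvg_cst.
  by apply/funext => y; rewrite /g pos_upd.
Qed.

Let mean_lin2 : mean (fun w => lin w ^+ 2) <= G ^+ 2.
Proof.
have -> : (fun w => lin w ^+ 2) = (fun w => \sum_(l < d) g w ord0 l * lin w * w (s, l)).
  apply/funext => w; rewrite expr2 {1}/lin mulr_suml; apply: eq_bigr => l _.
  by rewrite mulrAC; congr (_ * _); rewrite mxE.
rewrite (mean_sum lmu (S := horizon)) => [|l _]; last first.
  apply: (@growthM _ _ _ 1 1) => //; last by apply: growth_coord; rewrite mem_horizon.
  by apply: (growthM _ (gg l 0) glin).
under eq_bigr do rewrite mean_lin.
rewrite -(mean_sum lmu (S := horizon)) => [|l _]; last by apply: (growth_sqr _ (gg l 0)).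
rewrite -[leRHS](mean_cst mu); apply: (ler_mean lmu (S := horizon)).
- by apply: growth_sum => l _; apply: (growth_sqr _ (gg l 0)).
- exact: growth_cst.
- by move=> w; rewrite -norm2_sqr ler_pXn2r ?nnegrE ?norm2_ge0 ?(ltW G0).
Qed.

Let gwk : growth 1 (fun w => w (s, k)).
Proof. by apply: growth_coord; rewrite mem_horizon. Qed.

(** Integrating by parts in one factor [w (s, k)] leaves [2 E[g_k lin w_k] + E[lin^2]], and the
    first mean is [E[g_k^2]] by [mean_lin]: three times [G^2], without a factor [d]. *)
Let mean_lin2_coord2 : mean (fun w => lin w ^+ 2 * w (s, k) ^+ 2) <= 3 * G ^+ 2.
Proof.
have -> : mean (fun w => lin w ^+ 2 * w (s, k) ^+ 2) =
    mean (fun w => 2 * (g w ord0 k * lin w * w (s, k)) + lin w ^+ 2).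
  have -> : (fun w => lin w ^+ 2 * w (s, k) ^+ 2) = (fun w => lin w ^+ 2 * w (s, k) * w (s, k)).
    by apply/funext => w; rewrite -mulrA -expr2.
  apply: (@mean_ibp _ _ mu lmu horizon).
  - by rewrite mem_horizon.
  - by apply: (growthM _ glin2 gwk).
  - apply: growthD; last exact: growthW glin2.
    by apply: growthZ; apply: (growthM (p := 1) _ _ gwk) => //; apply: (growthM _ (gg k 0) glin).
  - move=> w y; pose c := dot (g w) (pert w s - w (s, k) *: delta_mx ord0 k).
    rewrite (_ : (fun y => _) = fun y => (c + y * g w ord0 k) ^+ 2 * y).
      apply: is_derive_eq; rewrite lin_upd upd_same /g pos_upd// -/(g w) -/c /GRing.scale/=; ring.
    by apply/funext => z; rewrite lin_upd upd_same.
  - move=> w; pose c := dot (g w) (pert w s - w (s, k) *: delta_mx ord0 k).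
    rewrite (_ : (fun y => _) = fun y => 2 * (g w ord0 k * (c + y * g w ord0 k) * y) +
        (c + y * g w ord0 k) * (c + y * g w ord0 k)).
      have cl : continuous (fun y : R => c + y * g w ord0 k).
        by move=> y; apply: cvgD; [exact: cvg_cst|apply: cvgM; [exact: cvg_id|exact: cvg_cst]].
      move=> y; apply: cvgD; last first.
        by apply: cvgM; exact: cl.
      apply: cvgM; first exact: cvg_cst.
      by apply: cvgM; [apply: cvgM; [exact: cvg_cst|exact: cl]|exact: cvg_id].
    by apply/funext => y; rewrite lin_upd upd_same /g pos_upd// expr2.
rewrite (meanD lmu (S := horizon)); last 2 first.
- apply: growthZ; apply: (growthM (p := 1) _ _ gwk) => //.
  by apply: (growthM _ (gg k 0) glin).
- exact: growthW glin2.
rewrite (meanZ lmu (S := horizon)); last first.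
  apply: (growthM (p := 1) _ _ gwk) => //.
  by apply: (growthM _ (gg k 0) glin).
rewrite mean_lin.
have : mean (fun w => g w ord0 k ^+ 2) <= G ^+ 2.
  rewrite -[leRHS](mean_cst mu); apply: (ler_mean lmu (S := horizon)).
  - by apply: (growth_sqr _ (gg k 0)).
  - exact: growth_cst.
  - move=> w; rewrite -[leLHS]real_normK ?num_real// ler_pXn2r ?nnegrE ?(ltW G0)//.
    exact: le_trans (ler_coord_norm2 _ _) (g_le w).
by have := mean_lin2; lra.
Qed.

Let growth_coord6 l : growth 3 (fun w => w (s, l) ^+ 6).
Proof.
have g2 : growth 1 (fun w => w (s, l) ^+ 2) by apply: growth_coord_sqr; rewrite mem_horizon.
rewrite (_ : (fun w => _) = fun w => w (s, l) ^+ 2 * (w (s, l) ^+ 2 * w (s, l) ^+ 2)).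
  by apply: (growthM (q := 2) _ g2) => //; apply: (growthM _ g2 g2).
by apply/funext => w; rewrite -!exprD.
Qed.

Lemma mean_dquotM_sqr :
  mean (fun w => (dquot (f j) u (pos w s) (pert w s) * w (s, k)) ^+ 2) <= 4 * G ^+ 2.
Proof.
have mp l : measurable_fun setT (fun w => pos w s ord0 l) by exact: measurable_pos (ltnW sm).
pose c := L * u / 2.
have g1 : growth 3 (fun w => 5 / 4 * (lin w ^+ 2 * w (s, k) ^+ 2)).
  by apply: growthZ; apply: (growthM (q := 2) _ glin2) => //; apply: (growth_sqr _ gwk).
have g2 : growth 3 (fun w => 5 * c ^+ 2 * d%:R ^+ 3 * \sum_(l < d) w (s, l) ^+ 6).
  by apply: growthZ; apply: growth_sum.
apply: (@le_trans _ _ (mean (fun w => 5 / 4 * (lin w ^+ 2 * w (s, k) ^+ 2) +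
    5 * c ^+ 2 * d%:R ^+ 3 * \sum_(l < d) w (s, l) ^+ 6))).
  apply: (ler_mean lmu (S := horizon)).
  - by apply: (growth_sqr _ (growth_dquotM j k sm mp)).
  - exact: growthD.
  - move=> w; set D := dquot _ _ _ _; set z := pert w s.
    have e1 : `|D - lin w| <= c * norm2 z ^+ 2 by exact: (dquot_linear u0 (sf j)).
    have c0 : 0 <= c by rewrite divr_ge0// mulr_ge0 ?ltW.
    have e2 : (D - lin w) ^+ 2 <= c ^+ 2 * norm2 z ^+ 4.
      rewrite -[leLHS]real_normK ?num_real// (_ : norm2 z ^+ 4 = (norm2 z ^+ 2) ^+ 2); last by rewrite -exprM.
      by rewrite -exprMn ler_pXn2r ?nnegrE// mulr_ge0// sqr_ge0.
    have e3 : w (s, k) ^+ 2 <= norm2 z ^+ 2.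
      rewrite -[leLHS]real_normK ?num_real// ler_pXn2r ?nnegrE ?norm2_ge0//.
      by have := ler_coord_norm2 z k; rewrite mxE.
    have e4 : norm2 z ^+ 6 <= d%:R ^+ 3 * \sum_(l < d) w (s, l) ^+ 6.
      have := @sum_cube_le R d (fun l => w (s, l) ^+ 2) (fun l => sqr_ge0 _).
      rewrite (_ : \sum_(l < d) w (s, l) ^+ 2 = norm2 z ^+ 2); last first.
        by rewrite norm2_sqr; apply: eq_bigr => l _; rewrite mxE.
      by rewrite -exprM; under eq_bigr do rewrite -exprM.
    rewrite exprMn.
    (* The Young weights 5/4 and 5 are tuned to the final bound: [5/4 * 3 G^2] from the linear part
       and [G^2 / 4] from the remainder make [4 G^2]. *)
    have e5 : D ^+ 2 <= 5 / 4 * lin w ^+ 2 + 5 * (D - lin w) ^+ 2.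
      by have := sqr_ge0 (lin w / 2 - 2 * (D - lin w)); nra.
    have e6 := ler_wpM2r (sqr_ge0 (w (s, k))) e5.
    have e7 : (D - lin w) ^+ 2 * w (s, k) ^+ 2 <= c ^+ 2 * (d%:R ^+ 3 * \sum_(l < d) w (s, l) ^+ 6).
      apply: (le_trans (ler_wpM2r (sqr_ge0 (w (s, k))) e2)).
      rewrite -mulrA ler_wpM2l ?sqr_ge0//; apply: le_trans e4.
      by rewrite (exprD _ 4 2) ler_wpM2l// exprn_ge0 ?norm2_ge0.
    move: e6 e7; move: ((D - lin w) ^+ 2) (D ^+ 2) (lin w ^+ 2) (w (s, k) ^+ 2) => p q r t.
    move: (c ^+ 2) (d%:R ^+ 3) (\sum_(_ < _) _) => p' q' r'; lra.
have g3 : growth 3 (fun w => lin w ^+ 2 * w (s, k) ^+ 2).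
  by apply: (growthM (q := 2) _ glin2) => //; apply: (growth_sqr _ gwk).
have g4 : growth 3 (fun w => \sum_(l < d) w (s, l) ^+ 6) by exact: growth_sum.
rewrite (meanD lmu g1 g2) (meanZ lmu _ g3) (meanZ lmu _ g4) (mean_sum lmu (S := horizon))//.
under eq_bigr do rewrite /path_mean (Rintegral_coord6 lmu).
rewrite sumr_const card_ord -[moment6 *+ d]mulr_natl.
have := mean_lin2_coord2; have := small_u.
have -> : 5 * c ^+ 2 * d%:R ^+ 3 * (d%:R * moment6) =
    4^-1 * (5 * L ^+ 2 * u ^+ 2 * (d%:R ^+ 4 * moment6)).
  by rewrite /c; field.
lra.
Qed.

End second_moment.

Lemma growth_dterm t j k : (t < m)%N -> growth 1 (fun w => dterm (pos w) w t j k).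
Proof.
move=> tm; rewrite /dterm; case E : (tau t (blk k) j) => [s|s]; last exact: growth_cst.
have st : (s <= t)%N by have := tau_le t (blk k) j; rewrite E lez_nat.
have sm := leq_ltn_trans st tm.
by apply: growth_dquotM => // l; exact: measurable_pos (ltnW sm).
Qed.

Lemma mean_dterm_sqr t j k : (t < m)%N ->
  mean (fun w => dterm (pos w) w t j k ^+ 2) <= 4 * G ^+ 2.
Proof.
move=> tm; rewrite /dterm; case E : (tau t (blk k) j) => [s|s].
  have st : (s <= t)%N by have := tau_le t (blk k) j; rewrite E lez_nat.
  by apply: mean_dquotM_sqr; exact: leq_ltn_trans tm.
by rewrite mean_cst expr0n mulr_ge0// sqr_ge0.
Qed.

Lemma growth_dir t k : (t < m)%N -> growth 1 (fun w => dir (pos w) w t ord0 k).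
Proof.
move=> tm; under eq_fun do rewrite mxE.
by apply: growthZ; apply: growth_sum => j _; exact: growth_dterm.
Qed.

Lemma mean_dir_sqr t k : (t < m)%N ->
  mean (fun w => dir (pos w) w t ord0 k ^+ 2) <= 4 * G ^+ 2.
Proof.
move=> tm.
have gd j : growth 3 (fun w => dterm (pos w) w t j k ^+ 2).
  by apply: (growth_sqr _ (growth_dterm j k tm)).
apply: (@le_trans _ _ (mean (fun w => n%:R^-1 * \sum_(j < n) dterm (pos w) w t j k ^+ 2))).
  apply: (ler_mean lmu (S := horizon)).
  - by apply: (growth_sqr _ (growth_dir k tm)).
  - by apply: growthZ; exact: growth_sum.
  - move=> w; rewrite mxE exprMn expr2 -mulrA ler_wpM2l ?invr_ge0// ler_pdivrMl ?ltr0n//.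
    exact: sqr_sum_le.
rewrite (meanZ lmu (S := horizon)); last exact: growth_sum.
rewrite (mean_sum lmu (S := horizon))// ler_pdivrMl ?ltr0n// (mulr_natl _ n).
by rewrite -[X in _ <= _ *+ X]card_ord -sumr_const; apply: ler_sum => j _; exact: mean_dterm_sqr.
Qed.

Lemma growth_pos_diff_sqr t s : (t <= m)%N -> (s <= m)%N ->
  growth 2 (fun w => norm2 (pos w t - pos w s) ^+ 2).
Proof.
move=> tm sm; rewrite (_ : (fun w => _) = fun w => \sum_(k < d) (pos w t ord0 k - pos w s ord0 k) ^+ 2).
  apply: growth_sum => k _; apply: (growth_sqr (p := 1)) => //.
  by apply: growthB; exact: growth_pos.
by apply/funext => w; rewrite norm2_sqr; apply: eq_bigr => k _; rewrite !mxE.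
Qed.

Lemma pos_diff w s e k : pos w (s + e) ord0 k - pos w s ord0 k =
  - eta * \sum_(r < e) dir (pos w) w (s + r) ord0 k.
Proof.
elim: e => [|e IH]; first by rewrite addn0 subrr big_ord0 mulr0.
by rewrite addnS posS_coord big_ord_recr/= mulrDr -IH mulNr addrAC.
Qed.

(** The directions may be correlated, since pairs can be reused, so the [e] increments are combined
    by Cauchy-Schwarz, which gives [e^2]. *)
Lemma mean_pos_diff_sqr s e : (s + e <= m)%N ->
  mean (fun w => norm2 (pos w (s + e) - pos w s) ^+ 2) <=
  eta ^+ 2 * e%:R ^+ 2 * (4 * G ^+ 2 * d%:R).
Proof.
move=> sem; have sm : (s <= m)%N by rewrite (leq_trans _ sem)// leq_addr.
have gd k (r : 'I_e) : growth 3 (fun w => dir (pos w) w (s + r) ord0 k ^+ 2).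
  by apply: (growth_sqr _ (growth_dir k _)) => //; rewrite (leq_trans _ sem)// ltn_add2l.
apply: (@le_trans _ _ (mean (fun w => eta ^+ 2 * e%:R *
    \sum_(k < d) \sum_(r < e) dir (pos w) w (s + r) ord0 k ^+ 2))).
  apply: (ler_mean lmu (S := horizon)).
  - by apply: (growthW _ (growth_pos_diff_sqr sem sm)).
  - by apply: growthZ; do 2 apply: growth_sum => ? _.
  - move=> w; rewrite norm2_sqr mulr_sumr; apply: ler_sum => k _.
    have -> : (pos w (s + e) - pos w s) ord0 k = pos w (s + e) ord0 k - pos w s ord0 k by rewrite !mxE.
    rewrite pos_diff exprMn sqrrN -mulrA ler_wpM2l ?sqr_ge0//.
    exact: sqr_sum_le.
rewrite (meanZ lmu (S := horizon)); last by do 2 apply: growth_sum => ? _.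
rewrite (expr2 e%:R) (mulrA (eta ^+ 2)) -(mulrA (_ * e%:R)).
apply: ler_wpM2l; first by rewrite mulr_ge0 ?sqr_ge0.
rewrite (mean_sum lmu (S := horizon)) => [|k _]; last exact: growth_sum.
apply: (@le_trans _ _ (\sum_(k < d) \sum_(r < e) 4 * G ^+ 2)).
  apply: ler_sum => k _; rewrite (mean_sum lmu (S := horizon))//; apply: ler_sum => r _.
  by apply: mean_dir_sqr; rewrite (leq_trans _ sem)// ltn_add2l.
by rewrite !sumr_const !card_ord -mulrnA -[_ *+ (e * d)]mulr_natl natrM; lra.
Qed.


Local Notation F := (objective f).

Let lF : lipschitz2 G F. Proof. exact: lipschitz2_objective. Qed.

Let sF : smooth2 L F. Proof. exact: smooth2_objective. Qed.

Let gradF_le v : norm2 (grad F v) <= G.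
Proof. by apply: norm2_grad_le => //; [exact: ltW|exact: sF.1]. Qed.

Lemma growth_gradF t k p : (t <= m)%N -> growth p (fun w => grad F (pos w t) ord0 k).
Proof. by move=> tm; apply: growth_grad => // i; exact: measurable_pos. Qed.

Lemma growth_mgrad t s j k p : (t <= m)%N ->
  growth p (fun w => mgrad (f j) u (pos w t) (pert w s) ord0 k).
Proof.
move=> tm; have mp l : measurable_fun setT (fun w => pos w t ord0 l) by exact: measurable_pos.
rewrite (_ : (fun w => _) = fun w => 2^-1 * (grad (f j) (pos w t + u *: pert w s) ord0 k +
    grad (f j) (pos w t + (- u) *: pert w s) ord0 k)).
  apply: growthZ; apply: growthD.
    exact: (growth_grad k p (lf j) (sf j) (measurable_pos_pert s u mp)).
  exact: (growth_grad k p (lf j) (sf j) (measurable_pos_pert s (- u) mp)).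
by apply/funext => w; rewrite [LHS]mxE [X in _ * X]mxE scaleNr.
Qed.

Lemma growth_dquot s j : (s < m)%N -> growth 1 (fun w => dquot (f j) u (pos w s) (pert w s)).
Proof.
move=> sm; apply: (@growth_dom _ _ _ _ _ (fun w => G * (1 + norm2 (pert w s) ^+ 2))).
- by apply: measurable_dquot => k; exact: measurable_pos (ltnW sm).
- by apply: growthZ; apply: growthD; [exact: growth_cst|exact: growth_pert_sqr].
- move=> w; apply: le_trans (normr_dquot_le (ltW G0) u0 (lf j) _ _) _.
  rewrite ler_wpM2l ?(ltW G0)//; have := sqr_ge0 (norm2 (pert w s) - 1).
  by have := norm2_ge0 (pert w s); nra.
Qed.

(* Gaussian integration by parts replaces D_j z_k by the k-th derivative of D_j;
   exchanging the perturbations of times s and t does not change the law. *)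
Lemma mean_grad_dquot s t j k : (s <= t)%N -> (t < m)%N ->
  mean (fun w => grad F (pos w s) ord0 k *
    (dquot (f j) u (pos w s) (pert w s) * w (s, k))) =
  mean (fun w => grad F (pos w s) ord0 k *
    mgrad (f j) u (pos w s) (pert w t) ord0 k).
Proof.
move=> st tm; have sm := leq_ltn_trans st tm; have sm' := ltnW sm.
transitivity (mean (fun w => grad F (pos w s) ord0 k *
    mgrad (f j) u (pos w s) (pert w s) ord0 k)); last first.
  have g3 : growth 3 (fun w => grad F (pos w s) ord0 k *
      mgrad (f j) u (pos w s) (pert w s) ord0 k).
    by apply: (growthM _ (growth_gradF k 0 sm') (growth_mgrad s j k 0 sm')).
  rewrite -[LHS](mean_perm lmu (swap_timeK s t) g3).
  apply: eq_Rintegral => w _.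
  have -> := pos_swap w st.
  have -> := pert_swap w s t.
  by [].
have -> : (fun w => grad F (pos w s) ord0 k * (dquot (f j) u (pos w s) (pert w s) * w (s, k))) =
  (fun w => grad F (pos w s) ord0 k * dquot (f j) u (pos w s) (pert w s) * w (s, k)).
  by apply/funext => w; rewrite mulrA.
apply: (mean_ibp lmu (S := horizon)).
- by rewrite mem_horizon.
- by apply: (growthM _ (growth_gradF k 0 sm') (growth_dquot j sm)).
- by apply: (growthM _ (growth_gradF k 0 sm') (growth_mgrad s j k 0 sm')).
- move=> w y; pose z := pert w s - w (s, k) *: delta_mx ord0 k.
  rewrite (_ : (fun y => _) = fun y => grad F (pos w s) ord0 k *
      dquot (f j) u (pos w s) (z + y *: delta_mx ord0 k)).
    have dd := is_derive_dquot u0 (sf j) (pos w s) z k y.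
    rewrite pos_upd// pert_upd; exact: (is_deriveZ (grad F (pos w s) ord0 k) dd).
  by apply/funext => r; rewrite pos_upd// pert_upd.
- move=> w; pose z := pert w s - w (s, k) *: delta_mx ord0 k.
  rewrite (_ : (fun y => _) = fun y => grad F (pos w s) ord0 k *
      mgrad (f j) u (pos w s) (z + y *: delta_mx ord0 k) ord0 k).
    move=> y; apply: cvgM; first exact: cvg_cst.
    exact: (continuous_mgrad_line (sf j)).
  apply/funext => r.
  have -> : pert (upd w (s, k) r) s = z + r *: delta_mx ord0 k by exact: pert_upd.
  have -> := pos_upd w k r (leqnn s).
  by [].
Qed.

(** * One step of descent under delays *)

Section drift.
Variables (t : nat) (lag : 'I_n -> 'I_n -> nat) (beta : R).
Hypotheses (tm : (t < m)%N) (d0 : (0 < d)%N) (beta0 : 0 < beta).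
(** Nonnegative stamps are guaranteed from time [B] on. In the bound that follows, [beta] stands for
    [bbar * sqrt n]. *)
Hypothesis lagE : forall i j, tau t i j = (lag i j)%:Z.
Hypothesis lag_le : \sum_(i < n) \sum_(j < n) (t - lag i j)%N%:R ^+ 2 <= n%:R * beta ^+ 2 :> R.

Let lagt i j : (lag i j <= t)%N.
Proof. by have := tau_le t i j; rewrite lagE lez_nat. Qed.

Let tm' : (t <= m)%N. Proof. exact: ltnW. Qed.

(* The weight that balances the two terms of Young's inequality. *)
Let c := (L * eta * beta)^-1.

Let c0 : 0 < c. Proof. by rewrite invr_gt0 !mulr_gt0. Qed.

Let p w k := grad F (pos w t) ord0 k.
Let ps w j k := grad F (pos w (lag (blk k) j)) ord0 k.
Let M w j k := mgrad (f j) u (pos w t) (pert w t) ord0 k.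
Let Ms w j k := mgrad (f j) u (pos w (lag (blk k) j)) (pert w t) ord0 k.
Let Y w j k := dterm (pos w) w t j k.

(** Split [p Y = (p - ps) Y + ps Y] and trade [ps Y], in mean, for
    [ps Ms = p M + p (Ms - M) - (p - ps) Ms]. Young's inequality with weight [c] on the three error
    products leaves [H]; its last bracket collects [Y^2], the bound [G^2] on [Ms^2], and [p^2]. *)
Let H w j k := p w k * M w j k - c * (p w k - ps w j k) ^+ 2 -
  c / 2 * (Ms w j k - M w j k) ^+ 2 - (2 * c)^-1 * (Y w j k ^+ 2 + G ^+ 2 + p w k ^+ 2).

Let gp k q : growth q (fun w => p w k). Proof. exact: growth_gradF. Qed.

Let gps j k q : growth q (fun w => ps w j k).
Proof. by apply: growth_gradF; exact: leq_trans tm'. Qed.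

Let gM j k q : growth q (fun w => M w j k). Proof. exact: growth_mgrad. Qed.

Let gMs j k q : growth q (fun w => Ms w j k).
Proof. by apply: growth_mgrad; exact: leq_trans tm'. Qed.

Let gY j k : growth 1 (fun w => Y w j k). Proof. exact: growth_dterm. Qed.

Let gH j k : growth 3 (fun w => H w j k).
Proof.
apply: growthB; [apply: growthB; [apply: growthB|]|].
- by apply: (growthM _ (gp k 0) (gM j k 0)).
- by apply: growthZ; apply: (growth_sqr (p := 0)) => //; apply: growthB.
- by apply: growthZ; apply: (growth_sqr (p := 0)) => //; apply: growthB.
- apply: growthZ; apply: growthD; last by apply: (growth_sqr _ (gp k 0)).
  by apply: growthD; [apply: (growth_sqr _ (gY j k))|exact: growth_cst].
Qed.

Let young (a b : R) : - (c / 2 * a ^+ 2) - (2 * c)^-1 * b ^+ 2 <= a * b.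
Proof.
have := mulr_ge0 (ltW c0) (sqr_ge0 (a + c^-1 * b)).
have -> : c * (a + c^-1 * b) ^+ 2 = c * a ^+ 2 + 2 * (a * b) + c^-1 * b ^+ 2.
  by field; rewrite gt_eqF.
have -> : (2 * c)^-1 = c^-1 / 2 by field; rewrite gt_eqF.
lra.
Qed.

Let mean_H j k : mean (fun w => H w j k) <= mean (fun w => p w k * Y w j k).
Proof.
have YE : (fun w => Y w j k) = (fun w => dquot (f j) u (pos w (lag (blk k) j))
    (pert w (lag (blk k) j)) * w (lag (blk k) j, k)).
  by apply/funext => w; rewrite /Y /dterm lagE.
have g1 : growth 3 (fun w => (p w k - ps w j k) * Y w j k).
  by apply: (growthM (p := 0) _ _ (gY j k)) => //; exact: growthB.
have g2 : growth 3 (fun w => ps w j k * Y w j k) by apply: (growthM _ (gps j k 0) (gY j k)).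
have g3 : growth 3 (fun w => ps w j k * Ms w j k) by apply: (growthM _ (gps j k 0) (gMs j k 0)).
have -> : mean (fun w => p w k * Y w j k) =
    mean (fun w => (p w k - ps w j k) * Y w j k + ps w j k * Ms w j k).
  rewrite (meanD lmu g1 g3) -(mean_grad_dquot j k (lagt (blk k) j) tm).
  have -> : (fun w => grad F (pos w (lag (blk k) j)) ord0 k *
      (dquot (f j) u (pos w (lag (blk k) j)) (pert w (lag (blk k) j)) * w (lag (blk k) j, k))) =
      (fun w => ps w j k * Y w j k).
    by apply/funext => w; have /= -> := congr1 (@^~ w) YE.
  rewrite -(meanD lmu g1 g2); congr (path_mean _ _); apply/funext => w; ring.
apply: (ler_mean lmu (S := horizon)) => //; first exact: growthD.
move=> w.
have y1 := young (p w k - ps w j k) (Y w j k).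
have y2 := young (- (p w k - ps w j k)) (Ms w j k).
have y3 := young (Ms w j k - M w j k) (p w k).
have Mb : Ms w j k ^+ 2 <= G ^+ 2.
  rewrite -[leLHS]real_normK ?num_real// ler_pXn2r ?nnegrE ?(ltW G0)//.
  exact: (normr_mgrad_le u (ltW G0) (lf j) (sf j)).
have c1 : 0 <= (2 * c)^-1 by rewrite invr_ge0 mulr_ge0// ltW.
have := ler_wpM2l c1 Mb; rewrite /H.
move: (p w k) (ps w j k) (Y w j k) (Ms w j k) (M w j k) ((2 * c)^-1) y1 y2 y3 => a b y q r e.
rewrite sqrrN; move: c => c'; lra.
Qed.

(** A lower bound for [H] summed over [k] and averaged over [j]: [3/2] is [1 + 1/2] from the two
    displacement errors, which share one bound, and the final [G^2] bounds [norm2 (grad F) ^+ 2]. *)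
Let K w := 2^-1 * norm2 (grad F (pos w t)) ^+ 2 - 2^-1 * (L * u) ^+ 2 * norm2 (pert w t) ^+ 2 -
  n%:R^-1 * (3 / 2 * c * L ^+ 2) *
    (\sum_(j < n) \sum_(i < n) norm2 (pos w t - pos w (lag i j)) ^+ 2) -
  n%:R^-1 * (2 * c)^-1 * (\sum_(j < n) \sum_(k < d) Y w j k ^+ 2) -
  (2 * c)^-1 * (d%:R * G ^+ 2 + G ^+ 2).

Let block_le w j (V : 'I_n -> 'rV[R]_d) :
  (forall i, norm2 (V i) <= L * norm2 (pos w t - pos w (lag i j))) ->
  \sum_(k < d) V (blk k) ord0 k ^+ 2 <=
  L ^+ 2 * \sum_(i < n) norm2 (pos w t - pos w (lag i j)) ^+ 2.
Proof.
move=> hV; apply: le_trans (sum_block_sqr_le blk V) _.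
rewrite mulr_sumr; apply: ler_sum => i _; rewrite -exprMn.
by rewrite ler_pXn2r ?nnegrE ?mulr_ge0 ?norm2_ge0 ?(ltW L0).
Qed.

Let sum_p w j : \sum_(k < d) (p w k - ps w j k) ^+ 2 <=
  L ^+ 2 * \sum_(i < n) norm2 (pos w t - pos w (lag i j)) ^+ 2.
Proof.
apply: le_trans (block_le (V := fun i => grad F (pos w t) - grad F (pos w (lag i j))) _).
  apply: ler_sum => k _; rewrite /p /ps.
  by rewrite [X in _ <= X ^+ 2]mxE [X in _ <= (_ + X) ^+ 2]mxE.
by move=> i; exact: sF.2.
Qed.

Let sum_M w j : \sum_(k < d) (Ms w j k - M w j k) ^+ 2 <=
  L ^+ 2 * \sum_(i < n) norm2 (pos w t - pos w (lag i j)) ^+ 2.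
Proof.
apply: le_trans (block_le (V := fun i => mgrad (f j) u (pos w t) (pert w t) -
   mgrad (f j) u (pos w (lag i j)) (pert w t)) _).
  apply: ler_sum => k _; rewrite -sqrrN opprB /M /Ms.
  by rewrite [X in _ <= X ^+ 2]mxE [X in _ <= (_ + X) ^+ 2]mxE.
by move=> i; exact: (mgrad_lipschitz u (sf j)).
Qed.

(** The point and the perturbation are now common to all coordinates, so the sums over [k] are inner
    products. Averaging over [j] gives the squared gradient of [F] and a bias of at most
    [|grad F| L u |z|], split by Young's inequality. *)
Let sum_pM w : 2^-1 * norm2 (grad F (pos w t)) ^+ 2 -
    2^-1 * (L * u) ^+ 2 * norm2 (pert w t) ^+ 2 <=
  n%:R^-1 * \sum_(j < n) \sum_(k < d) p w k * M w j k.
Proof.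
set g := grad F (pos w t); set z := pert w t.
have nn : n%:R != 0 :> R by rewrite pnatr_eq0 -lt0n.
have -> : n%:R^-1 * \sum_(j < n) \sum_(k < d) p w k * M w j k =
    n%:R^-1 * \sum_(j < n) dot g (mgrad (f j) u (pos w t) z - grad (f j) (pos w t)) + norm2 g ^+ 2.
  have -> : norm2 g ^+ 2 = n%:R^-1 * \sum_(j < n) dot g (grad (f j) (pos w t)).
    rewrite norm2_sqrE {1}/g (grad_objective sf) dotZl; congr (_ * _).
    rewrite /dot [RHS]exchange_big/=; apply: eq_bigr => k _.
    by rewrite summxE mulr_suml; apply: eq_bigr => j _; rewrite mulrC.
  rewrite -mulrDr -big_split/=; congr (_ * _); apply: eq_bigr => j _.
  by rewrite !(dotC g) -dotDl subrK dotC.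
have h j : - (norm2 g * (L * u * norm2 z)) <=
    dot g (mgrad (f j) u (pos w t) z - grad (f j) (pos w t)).
  have := normr_dot_le g (mgrad (f j) u (pos w t) z - grad (f j) (pos w t)).
  rewrite ler_norml => /andP[+ _]; apply: le_trans; rewrite lerN2 ler_wpM2l ?norm2_ge0//.
  exact: (mgrad_grad u0 (sf j)).
have hs : - (norm2 g * (L * u * norm2 z)) <=
    n%:R^-1 * \sum_(j < n) dot g (mgrad (f j) u (pos w t) z - grad (f j) (pos w t)).
  rewrite ler_pdivlMl ?ltr0n// (mulr_natl _ n).
  by rewrite -[X in _ *+ X <= _]card_ord -sumr_const; exact: ler_sum.
apply: le_trans (lerD hs (lexx _)).
have := sqr_ge0 (norm2 g - L * u * norm2 z).
by rewrite exprMn; nra.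
Qed.

Let K_le w : K w <= n%:R^-1 * \sum_(j < n) \sum_(k < d) H w j k.
Proof.
have n1 : 0 <= n%:R^-1 :> R by rewrite invr_ge0.
have nn : n%:R != 0 :> R by rewrite pnatr_eq0 -lt0n.
have c1 : 0 < (2 * c)^-1 by rewrite invr_gt0 mulr_gt0.
have HE : \sum_(j < n) \sum_(k < d) H w j k =
    \sum_(j < n) \sum_(k < d) p w k * M w j k -
    c * \sum_(j < n) \sum_(k < d) (p w k - ps w j k) ^+ 2 -
    c / 2 * \sum_(j < n) \sum_(k < d) (Ms w j k - M w j k) ^+ 2 -
    (2 * c)^-1 * (\sum_(j < n) \sum_(k < d) Y w j k ^+ 2 +
      n%:R * (d%:R * G ^+ 2) + n%:R * norm2 (grad F (pos w t)) ^+ 2).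
  have E1 : n%:R * (d%:R * G ^+ 2) = \sum_(j < n) \sum_(k < d) G ^+ 2.
    by rewrite !sumr_const !card_ord (mulr_natl _ n) (mulr_natl _ d).
  have E2 : n%:R * norm2 (grad F (pos w t)) ^+ 2 = \sum_(j < n) \sum_(k < d) p w k ^+ 2.
    by rewrite sumr_const card_ord mulr_natl norm2_sqr.
  rewrite E1 E2 -!big_split/= !mulr_sumr -!sumrB; apply: eq_bigr => j _.
  by rewrite -!big_split/= !mulr_sumr -!sumrB; apply: eq_bigr => k _.
have s1 : \sum_(j < n) \sum_(k < d) (p w k - ps w j k) ^+ 2 <=
    L ^+ 2 * \sum_(j < n) \sum_(i < n) norm2 (pos w t - pos w (lag i j)) ^+ 2.
  by rewrite mulr_sumr; apply: ler_sum => j _; exact: sum_p.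
have s2 : \sum_(j < n) \sum_(k < d) (Ms w j k - M w j k) ^+ 2 <=
    L ^+ 2 * \sum_(j < n) \sum_(i < n) norm2 (pos w t - pos w (lag i j)) ^+ 2.
  by rewrite mulr_sumr; apply: ler_sum => j _; exact: sum_M.
have g2 : norm2 (grad F (pos w t)) ^+ 2 <= G ^+ 2.
  by rewrite ler_pXn2r ?nnegrE ?norm2_ge0 ?(ltW G0).
have pM := sum_pM w.
have := ler_wpM2l (mulr_ge0 n1 (ltW c0)) s1; have := ler_wpM2l (mulr_ge0 n1 (ltW c0)) s2.
have := ler_wpM2l (ltW c1) g2.
rewrite HE /K; move: pM.
move: (\sum_(j < n) \sum_(k < d) p w k * M w j k) (\sum_(j < n) \sum_(k < d) (p w k - ps w j k) ^+ 2)
  (\sum_(j < n) \sum_(k < d) (Ms w j k - M w j k) ^+ 2) (\sum_(j < n) \sum_(k < d) Y w j k ^+ 2)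
  (\sum_(j < n) \sum_(i < n) _) => A B C D S.
move: (norm2 (grad F (pos w t)) ^+ 2) (norm2 (pert w t) ^+ 2) ((2 * c)^-1) ((L * u) ^+ 2) => N Z e lu.
have -> : n%:R^-1 * (A - c * B - c / 2 * C - e * (D + n%:R * (d%:R * G ^+ 2) + n%:R * N)) =
    n%:R^-1 * A - n%:R^-1 * c * B - n%:R^-1 * c * C / 2 - n%:R^-1 * e * D -
    e * (d%:R * G ^+ 2) - e * N.
  by field.
move: (n%:R^-1) (c) (d%:R) (G ^+ 2) (L ^+ 2) => ni c' d' G2 L2; lra.
Qed.

Let gpd i j : growth 3 (fun w => norm2 (pos w t - pos w (lag i j)) ^+ 2).
Proof. by apply: (growthW _ (growth_pos_diff_sqr tm' (leq_trans (lagt i j) tm'))). Qed.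

Let gY2 j k : growth 3 (fun w => Y w j k ^+ 2).
Proof. by apply: (growth_sqr _ (gY j k)). Qed.

Let gN : growth 3 (fun w => norm2 (grad F (pos w t)) ^+ 2).
Proof.
rewrite (_ : (fun w => _) = fun w => \sum_(k < d) p w k ^+ 2).
  by apply: growth_sum => k _; apply: (growth_sqr _ (gp k 0)).
by apply/funext => w; rewrite norm2_sqr.
Qed.

Let gZ : growth 3 (fun w => norm2 (pert w t) ^+ 2).
Proof. by apply: (growthW _ (growth_pert_sqr tm)). Qed.

Let gSpd : growth 3 (fun w => \sum_(j < n) \sum_(i < n) norm2 (pos w t - pos w (lag i j)) ^+ 2).
Proof. by do 2 apply: growth_sum => ? _. Qed.

Let gSY : growth 3 (fun w => \sum_(j < n) \sum_(k < d) Y w j k ^+ 2).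
Proof. by do 2 apply: growth_sum => ? _. Qed.

Let mean_K : mean K = 2^-1 * mean (fun w => norm2 (grad F (pos w t)) ^+ 2) -
    2^-1 * (L * u) ^+ 2 * d%:R -
  n%:R^-1 * (3 / 2 * c * L ^+ 2) *
    (\sum_(j < n) \sum_(i < n) mean (fun w => norm2 (pos w t - pos w (lag i j)) ^+ 2)) -
  n%:R^-1 * (2 * c)^-1 * (\sum_(j < n) \sum_(k < d) mean (fun w => Y w j k ^+ 2)) -
  (2 * c)^-1 * (d%:R * G ^+ 2 + G ^+ 2).
Proof.
have g1 := growthZ 2^-1 gN.
have g2 := growthZ (2^-1 * (L * u) ^+ 2) gZ.
have g3 := growthZ (n%:R^-1 * (3 / 2 * c * L ^+ 2)) gSpd.
have g4 := growthZ (n%:R^-1 * (2 * c)^-1) gSY.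
have g5 := growth_cst horizon 3 ((2 * c)^-1 * (d%:R * G ^+ 2 + G ^+ 2)).
have g12 := growthB g1 g2; have g123 := growthB g12 g3; have g1234 := growthB g123 g4.
rewrite (meanB lmu g1234 g5) (meanB lmu g123 g4) (meanB lmu g12 g3) (meanB lmu g1 g2).
rewrite (meanZ lmu _ gN) (meanZ lmu _ gZ) (meanZ lmu _ gSpd) (meanZ lmu _ gSY) mean_cst.
rewrite (mean_pert_sqr tm); congr (_ - _ * _ - _ * _ - _).
  rewrite (mean_sum lmu (S := horizon)) => [|j _]; last exact: growth_sum.
  by apply: eq_bigr => j _; rewrite (mean_sum lmu (S := horizon)).
rewrite (mean_sum lmu (S := horizon)) => [|j _]; last exact: growth_sum.
by apply: eq_bigr => j _; rewrite (mean_sum lmu (S := horizon)).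
Qed.

Let gK : growth 3 K.
Proof.
apply: growthB; last exact: growth_cst.
apply: growthB; last exact: growthZ.
apply: growthB; last exact: growthZ.
by apply: growthB; exact: growthZ.
Qed.

Let mean_K_le : mean K <= mean (fun w => dot (grad F (pos w t)) (dir (pos w) w t)).
Proof.
have gpY j k : growth 3 (fun w => p w k * Y w j k) by apply: (growthM _ (gp k 0) (gY j k)).
have gSH : growth 3 (fun w => \sum_(j < n) \sum_(k < d) H w j k).
  by do 2 apply: growth_sum => ? _.
have gSpY : growth 3 (fun w => \sum_(j < n) \sum_(k < d) p w k * Y w j k).
  by do 2 apply: growth_sum => ? _.
have -> : (fun w => dot (grad F (pos w t)) (dir (pos w) w t)) =
    (fun w => n%:R^-1 * \sum_(j < n) \sum_(k < d) p w k * Y w j k).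
  apply/funext => w; rewrite exchange_big/= mulr_sumr; apply: eq_bigr => k _.
  by rewrite [X in _ * X]mxE mulrCA mulr_sumr.
apply: (@le_trans _ _ (mean (fun w => n%:R^-1 * \sum_(j < n) \sum_(k < d) H w j k))).
  by apply: (ler_mean lmu (S := horizon)) => //; exact: growthZ.
rewrite (meanZ lmu _ gSH) (meanZ lmu _ gSpY) ler_wpM2l ?invr_ge0//.
rewrite (mean_sum lmu (S := horizon)) => [|j _]; last exact: growth_sum.
rewrite [leRHS](mean_sum lmu (S := horizon)) => [|j _]; last exact: growth_sum.
apply: ler_sum => j _; rewrite (mean_sum lmu (S := horizon))//.
by rewrite [leRHS](mean_sum lmu (S := horizon))//; apply: ler_sum => k _; exact: mean_H.
Qed.

Lemma mean_drift_ge :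
  2^-1 * mean (fun w => norm2 (grad F (pos w t)) ^+ 2) - 2^-1 * (L * u) ^+ 2 * d%:R -
    9 * (L * eta * beta) * G ^+ 2 * d%:R <=
  mean (fun w => dot (grad F (pos w t)) (dir (pos w) w t)).
Proof.
apply: le_trans mean_K_le; rewrite mean_K.
have n1 : 0 < n%:R^-1 :> R by rewrite invr_gt0 ltr0n.
have nn : n%:R != 0 :> R by rewrite pnatr_eq0 -lt0n.
have d1 : 1 <= d%:R :> R by rewrite ler1n.
have hS : \sum_(j < n) \sum_(i < n) mean (fun w => norm2 (pos w t - pos w (lag i j)) ^+ 2) <=
    eta ^+ 2 * (4 * G ^+ 2 * d%:R) * (n%:R * beta ^+ 2).
  apply: (@le_trans _ _ (eta ^+ 2 * (4 * G ^+ 2 * d%:R) *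
      \sum_(i < n) \sum_(j < n) (t - lag i j)%N%:R ^+ 2)); last first.
    by rewrite ler_wpM2l// mulr_ge0 ?sqr_ge0// mulr_ge0// mulr_ge0// sqr_ge0.
  rewrite [X in _ <= _ * X]exchange_big/= mulr_sumr; apply: ler_sum => j _.
  rewrite mulr_sumr; apply: ler_sum => i _.
  have := @mean_pos_diff_sqr (lag i j) (t - lag i j)%N; rewrite subnKC// => /(_ tm').
  by move=> /le_trans; apply; rewrite mulrAC.
have hY : \sum_(j < n) \sum_(k < d) mean (fun w => Y w j k ^+ 2) <= n%:R * (d%:R * (4 * G ^+ 2)).
  rewrite (mulr_natl _ n) -[X in _ <= _ *+ X]card_ord -sumr_const; apply: ler_sum => j _.
  rewrite (mulr_natl _ d) -[X in _ <= _ *+ X]card_ord -sumr_const; apply: ler_sum => k _.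
  exact: mean_dterm_sqr.
have e1 : 0 <= n%:R^-1 * (3 / 2 * c * L ^+ 2).
  by rewrite mulr_ge0 ?(ltW n1)// mulr_ge0 ?sqr_ge0// mulr_ge0 ?(ltW c0)// divr_ge0.
have e2 : 0 <= n%:R^-1 * (2 * c)^-1 by rewrite mulr_ge0 ?(ltW n1)// invr_ge0 mulr_ge0// ltW.
have := ler_wpM2l e1 hS; have := ler_wpM2l e2 hY.
have q0 : 0 < L * eta * beta by rewrite !mulr_gt0.
(* With [c = 1 / (L eta beta)] every error is a multiple of [L eta beta G^2 d]: 6 from the
   displacements, 2 from [Y^2], and 1 from the two [G^2] terms, as [1 <= d]. *)
have -> : n%:R^-1 * (3 / 2 * c * L ^+ 2) * (eta ^+ 2 * (4 * G ^+ 2 * d%:R) * (n%:R * beta ^+ 2)) =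
    6 * (L * eta * beta) * G ^+ 2 * d%:R.
  by rewrite /c; field; rewrite nn !gt_eqF.
have -> : (2 * c)^-1 = (L * eta * beta) / 2 by rewrite /c; field; rewrite !gt_eqF.
have -> : n%:R^-1 * (L * eta * beta / 2) * (n%:R * (d%:R * (4 * G ^+ 2))) =
    2 * (L * eta * beta) * G ^+ 2 * d%:R by field.
have := ler_wpM2l (mulr_ge0 (ltW q0) (sqr_ge0 G)) d1.
move: (\sum_(j < n) _) (\sum_(j < n) _) (L * eta * beta) (path_mean _ _) ((L * u) ^+ 2) => A B q a lu.
move: (n%:R^-1) (G ^+ 2) (d%:R) (L ^+ 2) c => ni G2 d' L2 c'.
lra.
Qed.

Hypothesis beta1 : 1 <= beta.

Lemma growth_objective s : (s <= m)%N -> growth 1 (fun w => F (pos w s)).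
Proof.
move=> sm.
apply: (@growth_dom _ _ _ _ _ (fun w => `|F x0| + G * \sum_(k < d) `|pos w s ord0 k - x0 ord0 k|)).
- apply: (measurable_continuous_rV (lipschitz2_continuous lF)) => k.
  exact: measurable_pos.
- apply: growthD; first exact: growth_cst.
  apply: growthZ; apply: growth_sum => k _; apply: growth_normr.
  by apply: growthB; [exact: growth_pos|exact: growth_cst].
- move=> w; have h2 := lF (pos w s) x0.
  have h : G * norm2 (pos w s - x0) <= G * \sum_(k < d) `|pos w s ord0 k - x0 ord0 k|.
    rewrite ler_wpM2l ?(ltW G0)// (le_trans (norm2_le_sum _))// ler_sum// => k _.
    by rewrite [X in `|X|]mxE [X in _ + X]mxE.
  rewrite -{1}(subrK (F x0) (F (pos w s))) addrC.
  by rewrite (le_trans (ler_normD _ _))// lerD2l (le_trans h2).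
Qed.

(** The second-order term adds [2 L eta^2 G^2 d], which [1 <= beta] lets join the 9 of the drift to
    make 11. *)
Lemma mean_descent :
  mean (fun w => F (pos w t.+1)) <= mean (fun w => F (pos w t)) -
    eta / 2 * mean (fun w => norm2 (grad F (pos w t)) ^+ 2) +
    eta * (2^-1 * (L * u) ^+ 2 * d%:R + 11 * (L * eta * beta) * G ^+ 2 * d%:R).
Proof.
have gF : growth 3 (fun w => F (pos w t)) by apply: (growthW _ (growth_objective tm')).
have gF' : growth 3 (fun w => F (pos w t.+1)) by apply: (growthW _ (growth_objective tm)).
have gdot : growth 3 (fun w => dot (grad F (pos w t)) (dir (pos w) w t)).
  by apply: growth_sum => k _; apply: (growthM _ (gp k 0) (growth_dir k tm)).
have gdk k : growth 3 (fun w => dir (pos w) w t ord0 k ^+ 2).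
  by apply: (growth_sqr _ (growth_dir k tm)).
have gdir : growth 3 (fun w => \sum_(k < d) dir (pos w) w t ord0 k ^+ 2).
  exact: growth_sum.
have g1 := growthB gF (growthZ eta gdot); have g2 := growthZ (L / 2 * eta ^+ 2) gdir.
have : mean (fun w => F (pos w t.+1)) <=
    mean (fun w => F (pos w t) - eta * dot (grad F (pos w t)) (dir (pos w) w t) +
      L / 2 * eta ^+ 2 * \sum_(k < d) dir (pos w) w t ord0 k ^+ 2).
  apply: (ler_mean lmu (S := horizon)) => //; first exact: growthD.
  move=> w; have := smooth2_ub (pos w t) (- eta *: dir (pos w) w t) sF.
  rewrite scaleNr -posS norm2N norm2Z exprMn real_normK ?num_real// norm2_sqr mulrA.
  by rewrite dotC -scaleNr dotZl dotC mulNr.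
rewrite (meanD lmu g1 g2) (meanB lmu gF (growthZ eta gdot)) (meanZ lmu _ gdot) (meanZ lmu _ gdir).
have -> : mean (fun w => \sum_(k < d) dir (pos w) w t ord0 k ^+ 2) =
    \sum_(k < d) mean (fun w => dir (pos w) w t ord0 k ^+ 2).
  by rewrite (mean_sum lmu (S := horizon)).
move=> h; have hd : \sum_(k < d) mean (fun w => dir (pos w) w t ord0 k ^+ 2) <= d%:R * (4 * G ^+ 2).
  rewrite (mulr_natl _ d) -[X in _ <= _ *+ X]card_ord -sumr_const; apply: ler_sum => k _.
  exact: mean_dir_sqr.
have c1 : 0 <= L / 2 * eta ^+ 2 by rewrite mulr_ge0 ?sqr_ge0// divr_ge0// ltW.
have h1 := ler_wpM2l c1 hd; have h2 := ler_wpM2l (ltW eta0) mean_drift_ge.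
have h3 : L * eta ^+ 2 * (d%:R * G ^+ 2) <= L * eta ^+ 2 * (d%:R * G ^+ 2) * beta.
  by rewrite ler_peMr// mulr_ge0// ?mulr_ge0 ?sqr_ge0// ltW.
apply: (le_trans h).
move: (mean (fun w => F (pos w t))) (mean (fun w => dot _ _))
  (mean (fun w => norm2 _ ^+ 2)) (\sum_(_ < _) _) h1 h2 h3 => A B C D h1 h2 h3.
move: ((L * u) ^+ 2) h2 => lu h2.
move: (G ^+ 2) h1 h2 h3 => G2 h1 h2 h3.
move: (d%:R : R) h1 h2 h3 => d' h1 h2 h3.
lra.
Qed.

End drift.

(** With [r] the distance from [x0], Lipschitz continuity and [G r <= 2 G^2 r^2 + 1/8] replace
    descent on the steps before [B]; the second moment of [r] gives the rest. *)
Lemma mean_objective_start B : (B <= m)%N ->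
  mean (fun w => F (pos w B)) <= F x0 + (8^-1 + 8 * G ^+ 4 * eta ^+ 2 * B%:R ^+ 2 * d%:R).
Proof.
move=> Bm; have gr : growth 3 (fun w => norm2 (pos w B - pos w 0) ^+ 2).
  by apply: (growthW _ (growth_pos_diff_sqr Bm (leq0n m))).
have g2 := growthZ (2 * G ^+ 2) gr; have g1 := growth_cst horizon 3 (F x0 + 8^-1).
apply: (@le_trans _ _ (mean (fun w => F x0 + 8^-1 + 2 * G ^+ 2 * norm2 (pos w B - pos w 0) ^+ 2))).
  apply: (ler_mean lmu (S := horizon)).
  - by apply: (growthW _ (growth_objective Bm)).
  - exact: growthD.
  - move=> w; have := le_trans (ler_norm _) (lF (pos w B) (pos w 0)); rewrite pos0.
    have := sqr_ge0 (G * norm2 (pos w B - x0) - 4^-1).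
    move: (norm2 _) (F _) (F _) => r a b; nra.
rewrite (meanD lmu g1 g2) mean_cst (meanZ lmu _ gr) -addrA lerD2l lerD2l.
have := @mean_pos_diff_sqr 0 B Bm; rewrite add0n => h.
have := ler_wpM2l (mulr_ge0 (ler0n R 2) (sqr_ge0 G)) h => /le_trans; apply.
by rewrite (_ : G ^+ 4 = G ^+ 2 * G ^+ 2) -?exprD//; lra.
Qed.

End zfo_path.

Lemma sum_mean_grad_le (R : realType) (n d : nat) (f : 'I_n -> 'rV[R]_d -> R)
    (G L eta u beta Fs : R) (x0 : 'rV[R]_d) (blk : 'I_d -> 'I_n)
    (tau : nat -> 'I_n -> 'I_n -> int) (b : 'I_n -> 'I_n -> nat) (B T : nat)
    (mu : probability (@path_space R (nat * 'I_d)%type) R) :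
  (forall t i j, tau t i j <= t%:Z) ->
  (forall t i j, t%:Z - tau t i j <= (b i j)%:Z) -> (forall i j, (b i j <= B)%N) ->
  \sum_(i < n) \sum_(j < n) (b i j)%:R ^+ 2 <= n%:R * beta ^+ 2 :> R ->
  1 <= beta -> (0 < n)%N -> (0 < d)%N -> 0 < G -> 0 < L -> 0 < u -> 0 < eta ->
  (forall i, lipschitz2 G (f i)) -> (forall i, smooth2 L (f i)) ->
  (forall x, Fs <= objective f x) -> gaussian_law mu ->
  5 * L ^+ 2 * u ^+ 2 * (d%:R ^+ 4 * moment6) <= G ^+ 2 -> (B <= T)%N ->
  eta / 2 * (\sum_(B <= t < T.+1) path_mean mu (fun w =>
    norm2 (grad (objective f) (pos f eta u x0 blk tau w t)) ^+ 2)) <=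
  objective f x0 - Fs + (8^-1 + 8 * G ^+ 4 * eta ^+ 2 * B%:R ^+ 2 * d%:R) +
  (T.+1 - B)%N%:R *
    (eta * (2^-1 * (L * u) ^+ 2 * d%:R + 11 * (L * eta * beta) * G ^+ 2 * d%:R)).
Proof.
move=> tau_le tau_ge bB sb beta1 n0 d0 G0 L0 u0 eta0 lf sf Fs_le lmu su BT.
have beta0 : 0 < beta by exact: lt_le_trans beta1.
pose k := eta * (2^-1 * (L * u) ^+ 2 * d%:R + 11 * (L * eta * beta) * G ^+ 2 * d%:R).
pose a t := path_mean mu (fun w =>
  norm2 (grad (objective f) (pos f eta u x0 blk tau w t)) ^+ 2).
rewrite -/k (eq_bigr a)//.
pose E t := path_mean mu (fun w => objective f (pos f eta u x0 blk tau w t)).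
have step t : (B <= t < T.+1)%N -> eta / 2 * a t <= E t - E t.+1 + k.
  move=> /andP[Bt tT].
  (* For [B <= t] the delay bound forces [0 <= tau t i j], so the absolute value only changes the
     type. *)
  pose lag i j := `|tau t i j|%N.
  have lagE i j : tau t i j = (lag i j)%:Z.
    by have := tau_ge t i j; have := bB i j; rewrite /lag; lia.
  have lag_le : \sum_(i < n) \sum_(j < n) (t - lag i j)%N%:R ^+ 2 <= n%:R * beta ^+ 2 :> R.
    apply: le_trans sb; apply: ler_sum => i _; apply: ler_sum => j _.
    rewrite ler_pXn2r ?nnegrE// ler_nat.
    by have := tau_ge t i j; rewrite lagE; lia.
  have := mean_descent x0 blk tau_le n0 G0 L0 u0 eta0 lf sf lmu su tT d0 beta0 lagE lag_le beta1.
  rewrite -/k -/(E t) -/(E t.+1) -/(a t); lra.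
have ET : Fs <= E T.+1.
  rewrite -(mean_cst mu Fs); apply: (ler_mean lmu (S := horizon T.+1)) => //.
    exact: growth_cst.
  apply: (@growthW _ _ _ 1) => //.
  exact: (growth_objective _ _ _ tau_le n0 G0 u0 lf).
have EB : E B <= _ := mean_objective_start eta x0 blk tau_le n0 G0 L0 u0 lf sf lmu su (leqW BT).
have : \sum_(B <= t < T.+1) (eta / 2 * a t) <= \sum_(B <= t < T.+1) (E t - E t.+1 + k).
  by rewrite big_nat_cond [leRHS]big_nat_cond; apply: ler_sum => t /andP[tBT _]; exact: step.
rewrite -mulr_sumr big_split/= sumr_const_nat -mulr_natl.
under [X in _ <= X + _]eq_bigr do rewrite -opprB.
rewrite sumrN telescope_sumr ?(leqW BT)//; lra.
Qed.

(** * From runs of the algorithm to paths *)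

Section transfer.
Context {dsp : measure_display} {Omega : measurableType dsp} {R : realType}.
Variable P : probability Omega R.
Variables (n : nat) (dim : 'I_n -> nat) (e : rel 'I_n).
Local Notation d := (\sum_(i < n) dim i)%N.
Variables (f : 'I_n -> 'rV[R]_d -> R) (eta u : R) (x0 : 'rV[R]_d).
Variables (recv : nat -> 'I_n -> nat -> 'I_n -> bool).
Variables (Z : nat -> 'I_d -> {RV P >-> R}) (xi : bool -> nat -> 'I_n -> {RV P >-> R}).
Variables (D : nat -> 'I_n -> 'I_n -> Omega -> R) (tau : nat -> 'I_n -> 'I_n -> int).
Variable (x : nat -> Omega -> 'rV[R]_d).
Hypothesis run : zfo_run e f eta u 0 x0 recv Z xi D tau x.
Local Notation W := (@path_space R (nat * 'I_d)%type).

(** Pairs are only copied, so each is the initial one or was formed by [j] itself at its stamp. For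
    stamp -1 nothing is recorded about [D], which meets the factor [z(-1) = 0]. *)
Lemma zfo_pair t i j : (tau t i j = -1) \/
  exists s, [/\ (s <= t)%N, tau t i j = s%:Z & D t i j = D s j j].
Proof.
elim/ltn_ind: t i j => t IH i j.
have [<-|ji] := eqVneq j i.
  by right; exists t; split => //; exact: (zfo_own run t j).2.
have [[k _ [[s [st _ [-> ->]]]|[_ h]]] _] := zfo_adopt run t ji.
  have [->|[r [rs -> ->]]] := IH s st k j; [by left|right].
  by exists r; split => //; exact: leq_trans rs (ltnW st).
case: t IH h => [|t] IH /= h; case: h => -> ->; first by left.
have [->|[r [rt -> ->]]] := IH t (ltnSn t) i j; [by left|right].
by exists r; split => //; exact: leqW.
Qed.

Lemma zfo_tau_le t i j : tau t i j <= t%:Z.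
Proof. by have [->//|[s [st -> _]]] := zfo_pair t i j; rewrite lez_nat. Qed.

Definition noise_path (w : Omega) : W := fun a => Z a.1 a.2 w.

Lemma measurable_noise_path : measurable_fun setT noise_path.
Proof. by apply: measurable_path => a; exact: measurable_funPT. Qed.

Definition noise_path_mfun : {mfun Omega >-> W} :=
  HB.pack noise_path (isMeasurableFun.Build _ _ _ _ _ measurable_noise_path).

Definition noise_law : probability W R := distribution P noise_path_mfun.

Lemma gaussian_noise_law : gaussian_law noise_law.
Proof.
move=> s A us mA.
pose c (a : nat * 'I_d) : (nat * 'I_d) + (bool * nat * 'I_n) := inl a.
pose A' (b : (nat * 'I_d) + (bool * nat * 'I_n)) : set R := if b is inl a then A a else setT.
have := zfo_indep run (s := map c s) (A := A').
rewrite map_inj_uniq; last by move=> a b [].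
move=> /(_ us) /(_ _)/wrap[].
  by case => [a|b] /=; [exact: mA|exact: measurableT].
rewrite big_map => E.
transitivity (P (\bigcap_(a in [set` map c s]) (randomness Z xi a @^-1` A' a))).
  rewrite /noise_law /distribution /pushforward/=; congr (P _).
  apply/seteqP; split=> [w h b /= /mapP[a as_ ->]|w h a as_].
    by have := h a as_; rewrite /noise_path; case: a as_ {h} => t k.
  by have /= := h (c a) (map_f c as_); rewrite /noise_path; case: a as_ => t k.
rewrite E; apply: eq_bigr => -[t k] _ /=.
by rewrite -(zfo_normal run t k (mA (t, k))).
Qed.

(** Zero mean and variance at most 0 make the second moment vanish; enumerating the countably many
    indices by [unpickle] gives one null set for all. *)
Lemma noise_ae0 : {ae P, forall w s t i, xi s t i w = 0}.
Proof.
have xi0 s t i : {ae P, forall w, xi s t i w = 0}.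
  have := zfo_noise_var run s t i.
  rewrite expr0n/= /variance covariance.unlock (zfo_noise_mean run) expectation.unlock/= => V.
  have mx : measurable_fun setT (fun w => (xi s t i w ^+ 2)%:E).
    by apply/measurable_EFinP/measurable_funX; exact: measurable_funPT.
  have : (\int[P]_w `|(xi s t i w ^+ 2)%:E| = 0)%E.
    apply/eqP; rewrite eq_le integral_ge0// andbT; apply: le_trans V.
    rewrite le_eqVlt; apply/orP; left; apply/eqP; apply: eq_integral => w _.
    by rewrite gee0_abs ?lee_fin ?sqr_ge0//= !fctE/= subr0 expr2.
  move/(ae_eq_integral_abs _ measurableT mx); apply: filterS => w /(_ I) /= [] /eqP.
  by rewrite sqrf_eq0 => /eqP.
have : {ae P, forall w (N : nat), if (unpickle N : option (bool * nat * 'I_n)) is Some p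
    then xi p.1.1 p.1.2 p.2 w = 0 else True}.
  apply: ae_foralln => N; case: unpickle => [p|]; last exact: aeW.
  exact: xi0.
apply: filterS => w h s t i; have := h (pickle (s, t, i)).
by rewrite pickleK.
Qed.

Lemma zfo_pos w : (forall s t i, xi s t i w = 0) ->
  forall t, x t w = pos f eta u x0 tagnat.sig1 tau (noise_path w) t.
Proof.
move=> w0; elim/ltn_ind => -[_|t IH]; first by rewrite (zfo_init run) pos0.
rewrite (zfo_step run) (posS _ _ _ _ _ zfo_tau_le) IH//; congr (_ - _ *: _).
apply/rowP => k; rewrite [LHS]mxE [LHS]mxE [RHS]mxE; congr (_ * _).
rewrite summxE; apply: eq_bigr => j _; rewrite [LHS]mxE [X in _ * X]mxE tagnat.sig2K /dterm.
have [tE|[s [st tE DE]]] := zfo_pair t (tagnat.sig1 k) j; rewrite tE/=.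
  by rewrite mxE mulr0.
rewrite mxE; congr (_ * _).
rewrite DE (zfo_own run s j).1 /zfo_diff !w0 !addr0 IH//.
Qed.

Lemma measurable_zvec s k : measurable_fun setT (fun w => zvec Z s w ord0 k).
Proof.
case: s => [t|t].
  rewrite (_ : (fun w => _) = fun w => Z t k w); first exact: measurable_funPT.
  by apply/funext => w; rewrite mxE.
by rewrite (_ : (fun w => _) = fun=> 0)//; apply/funext => w; rewrite mxE.
Qed.

Hypothesis cf : forall i, continuous (f i).

(** [x] agrees with the measurable [pos] only almost surely, which does not transfer measurability
    to an arbitrary [Omega]; the recursion is therefore followed with its noises. *)
Lemma measurable_zfo t k : measurable_fun setT (fun w => x t w ord0 k).
Proof.
elim/ltn_ind: t k => -[_|t IH] k; first by rewrite (_ : (fun w => _) = fun=> x0 ord0 k);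
    [exact: measurable_cst|apply/funext => w; rewrite (zfo_init run)].
have mzz s c l : (s <= t)%N -> measurable_fun setT (fun w => (x s w + c *: zvec Z s%:Z w) ord0 l).
  move=> st; rewrite (_ : (fun w => _) = fun w => x s w ord0 l + c * zvec Z s w ord0 l).
    by apply: measurable_funD; [exact: IH|apply: measurable_funM => //; exact: measurable_zvec].
  by apply/funext => w; rewrite [LHS]mxE [X in _ + X]mxE.
have mD i j : tau t i j != -1 -> measurable_fun setT (D t i j).
  have [->//|[s [st _ ->]] _] := zfo_pair t i j.
  rewrite (zfo_own run s j).1; apply: measurable_funM => //; apply: measurable_funB.
    apply: measurable_funD; last exact: measurable_funPT.
    by apply: (measurable_continuous_rV (@cf j)) => l; exact: mzz.
  apply: measurable_funD; last exact: measurable_funPT.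
  rewrite (_ : (fun w => _) = fun w => f j (x s w + (- u) *: zvec Z s w)).
    by apply: (measurable_continuous_rV (@cf j)) => l; exact: mzz.
  by apply/funext => w; rewrite scaleNr.
rewrite (_ : (fun w => _) = fun w => x t w ord0 k - eta * (n%:R^-1 *
    \sum_(j < n) D t (tagnat.sig1 k) j w * zvec Z (tau t (tagnat.sig1 k) j) w ord0 k)).
  apply: measurable_funB; first exact: IH.
  apply: measurable_funM => //; apply: measurable_funM => //.
  apply: measurable_sum => j.
  (* For stamp -1 [mD] is silent, but the product vanishes with [z(-1)]. *)
  have [tE|tE] := eqVneq (tau t (tagnat.sig1 k) j) (-1).
    rewrite tE (_ : (fun w => _) = fun=> 0)//; apply/funext => w.
    by rewrite [zvec _ _ _ _ _]mxE mulr0.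
  by apply: measurable_funM; [exact: mD|exact: measurable_zvec].
apply/funext => w; rewrite (zfo_step run) [LHS]mxE [X in _ + X]mxE [X in - X]mxE; congr (_ - _ * _).
rewrite [LHS]mxE [LHS]mxE; congr (_ * _); rewrite summxE; apply: eq_bigr => j _.
by rewrite [LHS]mxE [X in _ * X]mxE tagnat.sig2K.
Qed.

Lemma expectation_zfo (g : 'rV[R]_d -> R) t : continuous g -> (forall v, 0 <= g v) ->
  (forall k, measurable_fun setT (fun w : W => pos f eta u x0 tagnat.sig1 tau w t ord0 k)) ->
  ('E_P[fun w => g (x t w)] =
   \int[noise_law]_w (g (pos f eta u x0 tagnat.sig1 tau w t))%:E)%E.
Proof.
move=> cg g0 mpos; rewrite expectation.unlock.
have mg := measurable_continuous_rV cg mpos.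
rewrite (@ge0_integral_image_law _ _ _ _ _ P noise_law noise_path measurable_noise_path).
- apply: ae_eq_integral => //.
  + apply/measurable_EFinP; apply: (measurable_continuous_rV cg); exact: measurable_zfo.
  + by apply/measurable_EFinP; apply: (measurableT_comp mg); exact: measurable_noise_path.
  + by apply: filterS noise_ae0 => w w0 _ /=; rewrite (zfo_pos w0).
- by [].
- exact/measurable_EFinP.
- by move=> w; rewrite lee_fin.
Qed.

End transfer.

(** * Network distances and the averaged delay *)

Lemma gdist_gt0 (n : nat) (e : rel 'I_n) (i j : 'I_n) : i != j -> (0 < gdist e i j)%N.
Proof.
case: n e i j => [? []//|n] e i j ij; rewrite /gdist /=.
case: ifPn => // /existsP[p /andP[_]].
by rewrite tuple0/= (negbTE ij).
Qed.

Lemma gdist_le_Bmax (n : nat) (e : rel 'I_n) (Delta : nat) (i j : 'I_n) :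
  (gdist e i j + Delta <= Bmax e Delta)%N.
Proof.
rewrite /Bmax leq_add2r; apply: leq_trans (leq_bigmax i).
exact: (leq_bigmax j).
Qed.

Section bbar.
Context {R : realType} {n : nat}.
Variables (e : rel 'I_n) (Delta : nat).
Local Notation bb := (bbar R e Delta).
Let Sb := (\sum_(i < n) \sum_(j < n) (gdist e i j + Delta) ^ 2)%N.
Hypothesis bb0 : 0 < bb.

Let SbE : \sum_(i < n) \sum_(j < n) (gdist e i j + Delta)%:R ^+ 2 = Sb%:R :> R.
Proof.
rewrite /Sb natr_sum; apply: eq_bigr => i _; rewrite natr_sum; apply: eq_bigr => j _.
by rewrite natrX.
Qed.

Let Sb0 : (0 < Sb)%N.
Proof.
rewrite lt0n; apply/eqP => S0; move: bb0.
by rewrite /bbar SbE S0 mul0r sqrtr0 ltxx.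
Qed.

Lemma bbar_gt0_n : (0 < n)%N.
Proof. by move: Sb0; rewrite /Sb; case: n e => // e'; rewrite big_ord0. Qed.

Lemma Bmax_gt0 : (0 < Bmax e Delta)%N.
Proof.
rewrite lt0n; apply/eqP => B0; move: Sb0.
rewrite /Sb big1// => i _; rewrite big1// => j _.
by have := gdist_le_Bmax e Delta i j; rewrite B0 leqn0 => /eqP ->.
Qed.

Lemma sum_delay_sqr :
  \sum_(i < n) \sum_(j < n) (gdist e i j + Delta)%:R ^+ 2 =
  n%:R * (bb * Num.sqrt n%:R) ^+ 2 :> R.
Proof.
have nn : n%:R != 0 :> R by rewrite pnatr_eq0 -lt0n bbar_gt0_n.
have bb2 : bb ^+ 2 = Sb%:R / n%:R ^+ 2 by rewrite /bbar SbE sqr_sqrtr// divr_ge0 ?sqr_ge0.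
by rewrite exprMn bb2 (sqr_sqrtr (ler0n R n)) SbE; field.
Qed.

(** The squared delays sum to [n (bbar sqrt n)^2]. With two or more agents each row has an
    off-diagonal entry of at least 1, so the sum is at least [n]; for a single agent its positivity
    suffices. *)
Lemma bbar_sqrt_ge1 : 1 <= bb * Num.sqrt n%:R.
Proof.
have n0 := bbar_gt0_n.
have b0 : 0 <= bb * Num.sqrt n%:R by rewrite mulr_ge0 ?sqrtr_ge0// ltW.
rewrite -(@ler_pXn2r _ 2) ?nnegrE// expr1n.
rewrite -(@ler_pM2l _ n%:R) ?ltr0n// -sum_delay_sqr SbE mulr1 ler_nat.
have [n1|n1] := leqP n 1; first exact: leq_trans n1 Sb0.
rewrite -[leqLHS]card_ord -sum1_card; apply: leq_sum => i _.
have [j ij] : exists j : 'I_n, i != j.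
  have [->|i0] := eqVneq i (Ordinal n0); first by exists (Ordinal n1).
  by exists (Ordinal n0).
rewrite (bigD1 j)//= (leq_trans _ (leq_addr _ _))// expn_gt0 addn_gt0.
by rewrite gdist_gt0.
Qed.

End bbar.

(** The last two numerical premises are what small [eps] provides: one yields the smallness of [u]
    behind the second moment bound, the other keeps the increase of [F] before time [B] below a
    constant. *)
Lemma zfo_convergence (R : realType) (n : nat) (dim : 'I_n -> nat) (e : rel 'I_n)
    (Delta : nat) (f : 'I_n -> 'rV[R]_(\sum_(i < n) dim i) -> R)
    (x0 : 'rV[R]_(\sum_(i < n) dim i)) (G L eps eta u : R) (T : nat) :
  let d := (\sum_(i < n) dim i)%N in
  let F := objective f in
  let Fs := inf (range F) in
  let bb := bbar R e Delta in
  let B := Bmax e Delta in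
  0 < G -> 0 < L -> 0 < bb -> (0 < d)%N ->
  (forall i, lipschitz2 G (f i)) -> (forall i, smooth2 L (f i)) ->
  has_lbound (range F) -> 0 < eps -> 0 < eta -> 0 < u -> (B <= T)%N ->
  eta <= eps / (48 * L * G ^+ 2 * bb * Num.sqrt n%:R * d%:R) ->
  u <= Num.sqrt eps / (4 * L * Num.sqrt d%:R) ->
  6 / (eta * eps) * Num.max (F x0 - Fs) 1 <= (T - B + 1)%N%:R ->
  5 * eps * (d%:R ^+ 4 * moment6) <= 16 * d%:R * G ^+ 2 ->
  8 * G ^+ 2 * B%:R * d%:R * eps <= 48 * L * G ^+ 2 * bb * Num.sqrt n%:R * d%:R ->
  forall (dsp : measure_display) (Omega : measurableType dsp)
    (P : probability Omega R) (recv : nat -> 'I_n -> nat -> 'I_n -> bool)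
    (Z : nat -> 'I_(\sum_(i < n) dim i) -> {RV P >-> R})
    (xi : bool -> nat -> 'I_n -> {RV P >-> R})
    (D : nat -> 'I_n -> 'I_n -> Omega -> R)
    (tau : nat -> 'I_n -> 'I_n -> int)
    (x : nat -> Omega -> 'rV[R]_(\sum_(i < n) dim i)),
  zfo_run e f eta u 0 x0 recv Z xi D tau x ->
  (forall t i j, t%:Z - tau t i j <= (gdist e i j + Delta)%N%:Z) ->
  (((T - B + 1)%N%:R^-1)%:E *
      \sum_(B <= t < T.+1) 'E_P[fun w => (norm2 (grad F (x t w)) ^+ 2)%R]
    <= eps%:E)%E.
Proof.
move=> d F Fs bb B G0 L0 bb0 d0 lf sf lbF eps0 eta0 u0 BT eta_le u_le T_ge su sB.
move=> dsp Omega P recv Z xi D tau x run delay.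
have n0 := bbar_gt0_n bb0.
have beta1 := bbar_sqrt_ge1 bb0; set beta := bb * Num.sqrt n%:R in beta1.
have sb := sum_delay_sqr bb0; rewrite -/beta in sb.
have tau_le := zfo_tau_le run.
have cf i : continuous (f i) := lipschitz2_continuous (lf i).
have lmu := gaussian_noise_law run.
have sF := smooth2_objective n0 sf.
have cg k : continuous (fun v => grad F v ord0 k).
  exact: (lipschitz2_continuous (lipschitz2_grad k sF)).
have cN : continuous (fun v => norm2 (grad F v) ^+ 2).
  rewrite (_ : (fun v => _) = fun v => \sum_(k < d) grad F v ord0 k * grad F v ord0 k).
    apply: continuous_big => [|k _ v]; first exact: add_continuous.
    exact: (continuousM (@cg k v) (@cg k v)).
  by apply/funext => v; rewrite norm2_sqr; apply: eq_bigr => k _; rewrite expr2.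
pose a t := path_mean (noise_law Z) (fun w => norm2 (grad F (pos f eta u x0 tagnat.sig1 tau w t)) ^+ 2).
have aE t : (t < T.+1)%N -> 'E_P[fun w => (norm2 (grad F (x t w)) ^+ 2)%R]%E = (a t)%:E.
  move=> tT; rewrite (expectation_zfo run cf cN).
  - rewrite (meanE lmu (S := horizon T.+1))//.
    rewrite (_ : (fun w => _) = fun w => \sum_(k < d)
        grad F (pos f eta u x0 tagnat.sig1 tau w t) ord0 k ^+ 2).
      apply: growth_sum => k _; apply: (growth_sqr (p := 0)) => //.
      exact: (growth_gradF _ _ _ tau_le n0 G0 u0 lf sf k 0 (ltnW tT)).
    by apply/funext => w; rewrite norm2_sqr.
  - by move=> v; rewrite sqr_ge0.
  - by move=> k; exact: (measurable_pos _ _ _ tau_le G0 u0 lf k (ltnW tT)).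
have -> : (\sum_(B <= t < T.+1) 'E_P[fun w => (norm2 (grad F (x t w)) ^+ 2)%R])%E =
    (\sum_(B <= t < T.+1) a t)%:E.
  by rewrite -sumEFin; apply: eq_big_nat => t /andP[_ tT]; exact: aE.
have NE : (T - B + 1 = T.+1 - B)%N by rewrite addn1 subSn.
rewrite NE in T_ge *; rewrite -EFinM lee_fin.
have N0 : 0 < (T.+1 - B)%N%:R :> R by rewrite ltr0n subn_gt0 ltnS.
rewrite ler_pdivrMl//.
have d1 : 1 <= d%:R :> R by rewrite ler1n.
have sqd0 : 0 < Num.sqrt d%:R :> R by rewrite sqrtr_gt0 (lt_le_trans _ d1).
have sqn0 : 0 < Num.sqrt n%:R :> R by rewrite sqrtr_gt0 ltr0n.
have Gsq : 0 < G ^+ 2 by rewrite exprn_gt0.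
set den := 48 * L * G ^+ 2 * bb * Num.sqrt n%:R * d%:R in eta_le sB.
have denE : den = 48 * (L * beta * G ^+ 2 * d%:R) by rewrite /den /beta; ring.
have den0 : 0 < den by rewrite /den !mulr_gt0// (lt_le_trans _ d1).
have heta : eta * den <= eps by rewrite -ler_pdivlMr.
have hu : (L * u) ^+ 2 * d%:R <= eps / 16.
  have : u * (4 * L * Num.sqrt d%:R) <= Num.sqrt eps by rewrite -ler_pdivlMr// !mulr_gt0.
  rewrite -(@ler_pXn2r _ 2) ?nnegrE ?sqrtr_ge0 ?mulr_ge0 ?sqrtr_ge0 ?(ltW u0) ?(ltW L0)//.
  by rewrite sqr_sqrtr ?(ltW eps0)// !exprMn (sqr_sqrtr (ler0n R d)); lra.
have m60 : 0 <= moment6 :> R by apply: Rintegral_ge0 => y _; rewrite exprn_even_ge0.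
have su' : 5 * L ^+ 2 * u ^+ 2 * (d%:R ^+ 4 * moment6) <= G ^+ 2.
  have C60 : 0 <= d%:R ^+ 4 * moment6 :> R by rewrite mulr_ge0 ?exprn_ge0.
  have h := ler_wpM2r C60 hu; rewrite exprMn in h.
  rewrite -(@ler_pM2l _ (16 * d%:R)) ?mulr_gt0 ?(lt_le_trans _ d1)//.
  move: su h; rewrite -/d; move: (d%:R ^+ 4 * moment6) => C6.
  move: (L ^+ 2) (u ^+ 2) (G ^+ 2) (d%:R : R) => l v g d'; lra.
(* [sB] and the step size bound give [8 G^2 B d eta <= 1]; squaring, dividing by 8 and using
   [d <= d^2] give the claim. *)
have hB : 8 * G ^+ 4 * eta ^+ 2 * B%:R ^+ 2 * d%:R <= 8^-1.
  have q0 : 0 <= 8 * G ^+ 2 * B%:R * d%:R by rewrite !mulr_ge0// ltW.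
  have q1 : 8 * G ^+ 2 * B%:R * d%:R * eta <= 1.
    rewrite -(@ler_pM2r _ den)// mul1r -(mulrA _ eta den); apply: le_trans sB.
    exact: ler_wpM2l.
  have : (8 * G ^+ 2 * B%:R * d%:R * eta) ^+ 2 <= 1.
    by rewrite exprn_ile1// mulr_ge0// ltW.
  have : 64 * (G ^+ 2 * eta * B%:R) ^+ 2 * d%:R <= 64 * (G ^+ 2 * eta * B%:R) ^+ 2 * d%:R * d%:R.
    by rewrite ler_peMr// mulr_ge0// mulr_ge0// sqr_ge0.
  rewrite (_ : G ^+ 4 = (G ^+ 2) ^+ 2); last by rewrite -exprM.
  move: (G ^+ 2) (B%:R : R) (d%:R : R) => g b d'; lra.
have FsF v : Fs <= F v by apply: ge_inf => //; exists v.
have := sum_mean_grad_le x0 tagnat.sig1 tau_le delay (gdist_le_Bmax e Delta) _ beta1 n0 d0 G0 L0 u0 eta0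
  lf sf FsF lmu su' BT.
rewrite sb lexx => /(_ isT).
have -> : \sum_(B <= t < T.+1) path_mean (noise_law Z) (fun w => norm2
    (grad (objective f) (pos f eta u x0 tagnat.sig1 tau w t)) ^+ 2) = \sum_(B <= t < T.+1) a t.
  by [].
move: (\sum_(B <= t < T.+1) a t) => A main.
have [M [gM M1 hM]] : exists M, [/\ F x0 - Fs <= M, 1 <= M &
    6 * M <= (T.+1 - B)%N%:R * (eta * eps)].
  exists (Num.max (F x0 - Fs) 1); split; [by rewrite le_max lexx|by rewrite le_max lexx orbT|].
  by rewrite mulrAC ler_pdivrMr ?mulr_gt0// in T_ge.
have hk : 2^-1 * (L * u) ^+ 2 * d%:R + 11 * (L * eta * beta) * G ^+ 2 * d%:R <=
    eps / 32 + 11 / 48 * eps.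
  move: heta hu; rewrite denE; move: ((L * u) ^+ 2) (G ^+ 2) (d%:R : R) => lu gg d'; lra.
have hN := ler_wpM2l (ltW N0) (ler_wpM2l (ltW eta0) hk).
have h0 : 0 <= (T.+1 - B)%N%:R * (eta * eps) by rewrite !mulr_ge0// ltW.
rewrite -(@ler_pM2l _ (eta / 2)) ?divr_gt0//.
move: (_ + 11 * _ * _ * _) main hN {hk} => kk; move: (8 * G ^+ 4 * _ * _ * _) hB => hb hB.
move: ((T.+1 - B)%N%:R) hM h0 => N hM h0 main hN.
rewrite -/(F x0) in main; move: (F x0 - Fs) gM main => g gM main.
(* In units of [N eta eps / 96]: the start costs [g + 1/4 <= 5/4 M], at most 20; the step errors
   [1/32 + 11/48] cost 25; the target [eta / 2 * (N * eps)] allows 48. *)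
clear -gM M1 hM h0 hB main hN.
lra.
Qed.

(** [T] is the ceiling plus [B - 1]: [1 <= B] gives the lower bound, and for the upper one the -1
    pays for rounding up while [B] is at most [K / eps^2]. *)
Lemma iteration_count (R : realType) (M K eps : R) (B T : nat) :
  (0 < B)%N -> (B <= T)%N -> 0 < eps -> B%:R * eps ^+ 2 <= K ->
  Num.ceil (M * (K / eps ^+ 2)) = (T - B + 1)%N%:Z ->
  M * (K / eps ^+ 2) <= T%:R /\ T%:R <= (M + 1) * (K / eps ^+ 2).
Proof.
move=> B0 BT eps0 BK; set Q := M * _ => cE.
have BK' : B%:R <= K / eps ^+ 2 by rewrite ler_pdivlMr ?exprn_gt0.
have TB : (T - B + 1)%N%:R = T%:R - B%:R + 1 :> R by rewrite natrD natrB.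
have B1 : 1 <= B%:R :> R by rewrite ler1n.
have := ceil_itv Q; rewrite cE intrB mulr1z -pmulrn TB => /andP[lo hi].
rewrite mulrDl mul1r -/Q; split; lra.
Qed.

(** Choosing [c1] and [c2] before the network, the dimensions and the costs makes the Theta uniform
    in them, whereas [eps0] may depend on the instance. *)
Theorem theorem3 (R : realType) (G L gap : R) :
  exists c1 c2 : R, [/\ 0 < c1, 0 < c2 &
  forall (n : nat) (dim : 'I_n -> nat) (e : rel 'I_n) (Delta : nat)
    (f : 'I_n -> 'rV[R]_(\sum_(i < n) dim i) -> R)
    (x0 : 'rV[R]_(\sum_(i < n) dim i)),
  let d := (\sum_(i < n) dim i)%N in
  let F := objective f in
  let Fstar := inf (range F) in
  let bb := bbar R e Delta in
  let B := Bmax e Delta in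
  connected_graph e ->
  (forall i, lipschitz2 G (f i)) ->
  (forall i, smooth2 L (f i)) ->
  has_lbound (range F) ->
  F x0 - Fstar = gap ->
  exists2 eps0 : R, 0 < eps0 &
  forall (eps eta u : R) (T : nat),
  0 < eps -> eps <= eps0 -> 0 < eta -> 0 < u -> (B <= T)%N ->
  let eta_max : R := eps / (48 * L * G ^+ 2 * bb * Num.sqrt n%:R * d%:R) in
  let u_max : R := Num.sqrt eps / (4 * L * Num.sqrt d%:R) in
  let T_min := Num.ceil (6 / (eta * eps) * Num.max (F x0 - Fstar) 1) in
  (eta <= eta_max -> u <= u_max -> T_min <= (T - B + 1)%N%:Z ->
   forall (dsp : measure_display) (Omega : measurableType dsp)
     (P : probability Omega R) (sigma : R)
     (recv : nat -> 'I_n -> nat -> 'I_n -> bool)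
     (Z : nat -> 'I_(\sum_(i < n) dim i) -> {RV P >-> R})
     (xi : bool -> nat -> 'I_n -> {RV P >-> R})
     (D : nat -> 'I_n -> 'I_n -> Omega -> R)
     (tau : nat -> 'I_n -> 'I_n -> int)
     (x : nat -> Omega -> 'rV[R]_(\sum_(i < n) dim i)),
   zfo_run e f eta u sigma x0 recv Z xi D tau x ->
   sigma = 0 ->
   (forall t i j, t%:Z - tau t i j <= (gdist e i j + Delta)%N%:Z) ->
   (((T - B + 1)%N%:R^-1)%:E *
      \sum_(B <= t < T.+1) 'E_P[fun w => (norm2 (grad F (x t w)) ^+ 2)%R]
    <= eps%:E)%E)
  /\
  (eta = eta_max -> u = u_max -> T_min = (T - B + 1)%N%:Z ->
   c1 * (bb * Num.sqrt n%:R * d%:R / eps ^+ 2) <= T%:R /\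
   T%:R <= c2 * (bb * Num.sqrt n%:R * d%:R / eps ^+ 2))].
Proof.
(* 288 is 6 from the iteration count times 48 from the step size. The fallback 1 keeps [c] positive
   when [M] is not; no positive step size is then admissible. *)
pose M := 288 * L * G ^+ 2 * Num.max gap 1.
pose c := if 0 < M then M else 1.
have c0 : 0 < c by rewrite /c; case: ifP.
exists c, (c + 1); split => //; first by rewrite addr_gt0.
move=> n dim e Delta f x0 d F Fstar bb B _ lf sf lbF gapE.
pose den := 48 * L * G ^+ 2 * bb * Num.sqrt n%:R * d%:R.
have [den0|den0] := ltP 0 den; last first.
  (* Then eta_max <= 0, and no positive step size is admissible. *)
  exists 1 => // eps eta u T eps0 _ eta0 _ _ eta_max u_max T_min.
  have eta_max0 : eta_max <= 0 by rewrite /eta_max -/den mulr_ge0_le0 ?invr_le0// ltW.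
  split=> [h|h]; last by move: eta0; rewrite h ltNge eta_max0.
  by have := lt_le_trans eta0 (le_trans h eta_max0); rewrite ltxx.
have bb_ge0 : 0 <= bb by exact: sqrtr_ge0.
have dn : (0 < d)%N.
  by rewrite lt0n; apply/eqP => d0; move: den0; rewrite /den d0 mulr0 ltxx.
have d1 : 1 <= d%:R :> R by rewrite ler1n.
have bb0 : 0 < bb.
  rewrite lt_neqAle bb_ge0 andbT eq_sym; apply/eqP => b0.
  by move: den0; rewrite /den b0 mulr0 !mul0r ltxx.
have n0 := bbar_gt0_n bb0.
have sqn0 : 0 < Num.sqrt n%:R :> R by rewrite sqrtr_gt0 ltr0n.
have K0 : 0 < bb * Num.sqrt n%:R * d%:R by rewrite !mulr_gt0// (lt_le_trans _ d1).
have denE : den = 48 * (L * G ^+ 2) * (bb * Num.sqrt n%:R * d%:R) by rewrite /den; ring.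
have LG0 : 0 < L * G ^+ 2.
  by move: den0; rewrite denE pmulr_lgt0// pmulr_rgt0.
have Gn0 : G != 0 by apply: contraTneq LG0 => ->; rewrite expr0n mulr0 ltxx.
have L0 : 0 < L by move: LG0; rewrite pmulr_lgt0// exprn_even_gt0.
(* The denominator sees [G] only through its square; the sign comes from the Lipschitz bound at two
   distinct points. *)
have G0 : 0 < G.
  rewrite lt_neqAle eq_sym Gn0/=; case: (posnP n) => [n00|_]; first by rewrite n00 in n0.
  have := le_trans (normr_ge0 _) (lf (Ordinal n0) (delta_mx ord0 (Ordinal dn)) 0).
  rewrite subr0 pmulr_lge0//.
  have : 1 <= norm2 (delta_mx ord0 (Ordinal dn) : 'rV[R]_d).
    by have := ler_coord_norm2 (delta_mx ord0 (Ordinal dn) : 'rV[R]_d) (Ordinal dn); rewrite mxE !eqxx normr1.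
  exact: lt_le_trans.
have ME : M = 288 * (L * G ^+ 2) * Num.max gap 1 by rewrite /M mulrA.
have max0 : 0 < Num.max gap 1 by rewrite lt_max ltr01 orbT.
have M0 : 0 < M by rewrite ME pmulr_lgt0// pmulr_rgt0.
have cM : c = M by rewrite /c M0.
have m60 : 0 <= moment6 :> R by apply: Rintegral_ge0 => y _; rewrite exprn_even_ge0.
have C60 : 0 <= d%:R ^+ 4 * moment6 :> R by rewrite mulr_ge0 ?exprn_ge0.
(* [e1] serves the second moment bound, [e2] the steps before time [B], and [e3] with [eps <= 1]
   keeps [B] below [K / eps^2], where [K] is [bb * sqrt n * d]. The added 1 keeps each denominator
   positive. *)
pose e1 := 16 * d%:R * G ^+ 2 / (5 * (d%:R ^+ 4 * moment6) + 1).
pose e2 := den / (8 * G ^+ 2 * B%:R * d%:R + 1).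
pose e3 := bb * Num.sqrt n%:R * d%:R / (B%:R + 1).
have p1 : 0 < 5 * (d%:R ^+ 4 * moment6) + 1 :> R by rewrite ltr_wpDl// mulr_ge0.
have p2 : 0 < 8 * G ^+ 2 * B%:R * d%:R + 1 by rewrite ltr_wpDl// !mulr_ge0// ltW.
have p3 : 0 < B%:R + 1 :> R by rewrite ltr_wpDl.
exists (Num.min (Num.min 1 e1) (Num.min e2 e3)).
  rewrite !lt_min ltr01 !divr_gt0//= !mulr_gt0 ?exprn_gt0// (lt_le_trans _ d1)//.
move=> eps eta u T eps0; rewrite !le_min => /andP[/andP[eps1 epse1] /andP[epse2 epse3]].
move=> eta0 u0 BT eta_max u_max T_min.
rewrite ler_pdivlMr// in epse1; rewrite ler_pdivlMr// in epse2; rewrite ler_pdivlMr// in epse3.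
have s1 : 5 * eps * (d%:R ^+ 4 * moment6) <= 16 * d%:R * G ^+ 2 by lra.
have s2 : 8 * G ^+ 2 * B%:R * d%:R * eps <= den by lra.
have s3 : B%:R * eps ^+ 2 <= bb * Num.sqrt n%:R * d%:R.
  have : eps ^+ 2 <= eps by rewrite expr2 ler_piMr// ltW.
  by move=> /(ler_wpM2l (ler0n R B)); lra.
split=> [eta_le u_le Tge dsp Omega P sigma recv Z xi D tau x run sigma0 delay|etaE uE TE].
  rewrite sigma0 in run.
  apply: (zfo_convergence G0 L0 bb0 dn lf sf lbF eps0 eta0 u0 BT eta_le u_le _ s1 s2 run delay).
  by move: Tge; rewrite /T_min ceil_le_int -pmulrn.
rewrite cM; apply: (iteration_count (Bmax_gt0 bb0) BT eps0 s3).
rewrite -TE /T_min etaE /eta_max gapE -/den denE ME; congr Num.ceil.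
move: (L * G ^+ 2) (bb * Num.sqrt n%:R * d%:R) (Num.max gap 1) LG0 K0 => l k m l0 k0.
by field; rewrite !gt_eqF.
Qed.
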